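(* (a) $\delta\big(\langle V\rangle_{U_n},\phi\big)=\sqrt{n}\,\pi$ for every integer $n\ge1$ and every $V\in U_n$. (b) $\delta\big(\preccurlyeq Q\succcurlyeq_{SU_n},\phi\big)=\sqrt{n}\,\pi$ for every even integer $n\ge2$ and every $Q\in O_n$. (c) $\delta\big(\preccurlyeq Q\succcurlyeq_{SU_n},\phi\big)=\sqrt{n-1}\,\pi$ for every odd integer $n\ge1$ and every $Q\in O_n$.
   Context: $U_n$, $SU_n$, $O_n$ are the unitary, special unitary and real orthogonal groups of order $n$. $\langle V\rangle_{U_n}:=\{X\in U_n: XV=VX\}$ and $\preccurlyeq Q\succcurlyeq_{SU_n}:=\{X\in SU_n: XQ=Q\overline{X}\}$, where $\overline{X}$ is the entrywise complex conjugate; these are (compact connected) closed subgroups of $U_n$. For a closed subgroup $G$ of $U_n$, $\phi$ denotes the (bi-invariant) Riemannian metric on $G$ obtained by restricting to its tangent spaces the Frobenius scalar product $\phi(A,B):=Re(tr(AB^* ))$ of $\mathfrak{gl}_n(\mathbb{C})$, and $\delta(G,\phi)$ is the diameter of $G$ with respect to the Riemannian distance induced by $\phi$. *)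

(* Defs.v *)
From HB Require Import structures.
From mathcomp Require Import all_boot all_order all_algebra.
From mathcomp Require Import all_classical all_reals all_analysis.
From mathcomp Require Import complex.

Set Implicit Arguments.
Unset Strict Implicit.
Unset Printing Implicit Defensive.

Import Order.TTheory GRing.Theory Num.Theory numFieldNormedType.Exports.

Local Open Scope classical_set_scope.
Local Open Scope ring_scope.
Local Open Scope sesquilinear_scope.

(* In sesquilinear_scope, X ^t* is the conjugate transpose of X. *)

Definition U_ (R : realType) (n : nat) : set 'M[R[i]]_n :=
  [set X | X \is unitarymx].

Definition SU_ (R : realType) (n : nat) : set 'M[R[i]]_n :=
  [set X | U_ X /\ \det X = 1].

Definition O_ (R : realType) (n : nat) : set 'M[R]_n :=
  [set Q | Q *m Q^T = 1%:M].

Definition commutant_U (R : realType) (n : nat) (V : 'M[R[i]]_n) :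
    set 'M[R[i]]_n :=
  [set X | U_ X /\ X *m V = V *m X].

Definition twisted_commutant_SU (R : realType) (n : nat) (Q : 'M[R]_n) :
    set 'M[R[i]]_n :=
  [set X | SU_ X /\
    X *m map_mx (real_complex R) Q
    = map_mx (real_complex R) Q *m map_mx Num.conj X].

Definition frobenius (R : realType) (n : nat) (A B : 'M[R[i]]_n) : R :=
  complex.Re (\tr (A *m B ^t* )).

(* R[i] carries no R-normed module structure, so that real differentiability
   of matrix-valued curves is expressed on the real coordinates. *)
Definition re_entry (R : realType) (n : nat) (c : R -> 'M[R[i]]_n)
  (i j : 'I_n) : R -> R := fun t => complex.Re (c t i j).

Definition im_entry (R : realType) (n : nat) (c : R -> 'M[R[i]]_n)
  (i j : 'I_n) : R -> R := fun t => complex.Im (c t i j).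

Definition C1_fun (R : realType) (f : R -> R) : Prop :=
  (forall t, derivable f t 1) /\ continuous (derive1 f).

Definition C1_curve (R : realType) (n : nat) (c : R -> 'M[R[i]]_n) : Prop :=
  forall i j, C1_fun (re_entry c i j) /\ C1_fun (im_entry c i j).

(* The subdivision is 0 < s`_0 < ... < s`_(size s - 1) = 1; being C^1 on a
   closed piece means coinciding there with a C^1 curve defined on all of R.
   The values of c outside [0, 1] are irrelevant. *)
Definition piecewise_C1 (R : realType) (n : nat) (c : R -> 'M[R[i]]_n) :
    Prop :=
  exists s : seq R, [/\ path <%R 0 s, last 0 s = 1 &
    forall k, (k < size s)%N -> exists2 d : R -> 'M[R[i]]_n, C1_curve d &
      forall t, nth 0 (0 :: s) k <= t <= nth 0 s k -> c t = d t].

Definition velocity (R : realType) (n : nat) (c : R -> 'M[R[i]]_n) (t : R) :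
    'M[R[i]]_n :=
  \matrix_(i, j) Complex (derive1 (re_entry c i j) t) (derive1 (im_entry c i j) t).

(* For a piecewise C^1 curve the velocity is meaningless at the finitely many
   breakpoints only, and these do not contribute to the integral. *)
Definition curve_length (R : realType) (n : nat)
    (phi : 'M[R[i]]_n -> 'M[R[i]]_n -> R) (c : R -> 'M[R[i]]_n) : \bar R :=
  (\int[lebesgue_measure]_(t in `[0%R, 1%R])
     (Num.sqrt (phi (velocity c t) (velocity c t)))%:E)%E.

(* A closed subgroup G of U_n is an embedded submanifold of the space of complex
   matrices: the C^1 curves of G are the C^1 matrix-valued curves with values
   in G, their velocities are automatically tangent to G, and their Riemannian
   norm is computed by the ambient scalar product phi. *)
Definition curve_between (R : realType) (n : nat) (G : set 'M[R[i]]_n)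
    (X Y : 'M[R[i]]_n) : set (R -> 'M[R[i]]_n) :=
  [set c | [/\ piecewise_C1 c, (forall t, 0 <= t <= 1 -> G (c t)),
               c 0 = X & c 1 = Y]].

Definition riemannian_dist (R : realType) (n : nat) (G : set 'M[R[i]]_n)
    (phi : 'M[R[i]]_n -> 'M[R[i]]_n -> R) (X Y : 'M[R[i]]_n) : \bar R :=
  ereal_inf [set curve_length phi c | c in curve_between G X Y].

Definition diameter (R : realType) (n : nat) (G : set 'M[R[i]]_n)
    (phi : 'M[R[i]]_n -> 'M[R[i]]_n -> R) : \bar R :=
  ereal_sup [set z | exists X Y, [/\ G X, G Y & z = riemannian_dist G phi X Y]].

(* Main.v *)
Require Import Defs.
From HB Require Import structures.
From mathcomp Require Import all_boot all_order all_algebra.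
From mathcomp Require Import all_classical all_reals all_analysis.
From mathcomp Require Import complex.
From mathcomp Require Import measurable_realfun ring lra.

(* Upper bound. Write the quotient [Z = X^* Y] as [W^* D W] with [D] the diagonal
   of eigenvalues [exp (i theta_j)], [|theta_j| <= pi]; then
   [t |-> X W^* diag (exp (i t theta_j)) W] joins [X] to [Y] at the constant speed
   [sqrt (sum theta_j^2) <= sqrt n * pi].  It stays in the commutant of [V] because it
   is a function of [Z].  In the twisted case [v |-> Q (conj v)] is an antiunitary
   operator commuting with [Z], and the only obstruction is the eigenvalue [-1],
   whose argument is not an odd function: its eigenspace is split into two
   halves exchanged by that operator, rotated by [pi] and by [-pi].  Such a splitting
   exists because the eigenspace has even dimension, which follows from [det Z = 1].
   For odd [n], [1] is an eigenvalue of [Z], so one [theta_j] vanishes.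

   Lower bound. If [b t] is unitary, each row of [b] is a curve on a unit sphere, so
   that the angle [acos (Re b_jj)] varies at most as fast as the length of the [j]-th
   row of [b'].  A curve from [1] to a matrix with eigenvalue [-1] of multiplicity
   [m] has [m] such angles going from [0] to [pi], and Cauchy-Schwarz gives the
   length [sqrt m * pi] at least.  The far points are [-1] or, for odd [n],
   [2 P - 1] with [P] the projection onto a real line invariant under [Q]. *)

Set Implicit Arguments.
Unset Strict Implicit.
Unset Printing Implicit Defensive.

Import Order.TTheory GRing.Theory Num.Theory numFieldNormedType.Exports.

Local Open Scope classical_set_scope.
Local Open Scope ring_scope.
Local Open Scope sesquilinear_scope.

Local Notation cmx := (map_mx Num.conj).

(** * Unitary functional calculus *)

Section Adjoint.
Variable C : numClosedFieldType.
Implicit Types (m n p : nat).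

Lemma adjM m n p (A : 'M[C]_(m, n)) (B : 'M[C]_(n, p)) :
  (A *m B) ^t* = B ^t* *m A ^t*.
Proof. by rewrite trmx_mul map_mxM. Qed.

Lemma adjD m n (A B : 'M[C]_(m, n)) : (A + B) ^t* = A ^t* + B ^t*.
Proof. by rewrite linearD map_mxD. Qed.

Lemma adjN m n (A : 'M[C]_(m, n)) : (- A) ^t* = - A ^t*.
Proof. by rewrite linearN map_mxN. Qed.

Lemma adjZ m n (a : C) (A : 'M[C]_(m, n)) : (a *: A) ^t* = a^* *: A ^t*.
Proof. by rewrite linearZ map_mxZ. Qed.

Lemma adj1 n : (1%:M : 'M[C]_n) ^t* = 1%:M.
Proof. by rewrite trmx1 map_mx1. Qed.

Lemma scaler_half (V : lmodType C) (x : V) : 2^-1 *: (x + x) = x.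
Proof.
by rewrite scalerDr -scalerDl -mulr2n -[_ *+ 2]mulr_natr mulVf ?scale1r.
Qed.

Lemma unitary_adjK n (W : 'M[C]_n) : W \is unitarymx -> W ^t* *m W = 1%:M.
Proof. by move=> /unitarymxP /mulmx1C. Qed.

Lemma conjmxK m n (A : 'M[C]_(m, n)) : cmx (cmx A) = A.
Proof. by apply/matrixP => i j; rewrite !mxE conjCK. Qed.

Lemma adj_conj m n (A : 'M[C]_(m, n)) : (cmx A) ^t* = cmx (A ^t*).
Proof. by rewrite map_trmx. Qed.

Lemma det_adj n (A : 'M[C]_n) : \det (A ^t*) = (\det A)^*.
Proof. by rewrite -(det_tr A) -det_map_mx. Qed.

Lemma mxtrace_mul_adj m n (A : 'M[C]_(m, n)) :
  \tr (A *m A ^t*) = \sum_i \sum_j `|A i j| ^+ 2.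
Proof.
apply: eq_bigr => i _; rewrite mxE; apply: eq_bigr => j _.
by rewrite !mxE normCK.
Qed.

Lemma mxtrace_adj_eq0 m n (A : 'M[C]_(m, n)) : \tr (A *m A ^t*) = 0 -> A = 0.
Proof.
move=> /eqP; rewrite mxtrace_mul_adj psumr_eq0 => [/allP h|i _]; last first.
  by apply: sumr_ge0 => j _; apply: exprn_ge0.
apply/matrixP => i j; have := h i; rewrite mem_index_enum => /(_ isT).
rewrite psumr_eq0 => [/allP /(_ j)|k _]; last exact: exprn_ge0.
by rewrite mem_index_enum sqrf_eq0 normr_eq0 mxE => /(_ isT) /eqP.
Qed.

End Adjoint.

Section FunctionalCalculus.
Variables (C : numClosedFieldType) (n : nat).
Implicit Types (f g : C -> C) (W V : 'M[C]_n) (D : 'rV[C]_n).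

(* [f Z] for the normal matrix [Z = W^* D W]. *)
Definition mxfun f W D : 'M[C]_n := W ^t* *m diag_mx (map_mx f D) *m W.

Lemma eq_mxfun f g W D : (forall j, f (D 0 j) = g (D 0 j)) ->
  mxfun f W D = mxfun g W D.
Proof.
move=> fg; rewrite /mxfun; congr (_ *m diag_mx _ *m _).
by apply/rowP => j; rewrite !mxE.
Qed.

Lemma mxfunM f g W D : W \is unitarymx ->
  mxfun f W D *m mxfun g W D = mxfun (fun z => f z * g z) W D.
Proof.
move=> Wu; rewrite /mxfun !mulmxA mulmxtVK // -!mulmxA; congr (_ *m _).
rewrite mulmxA mulmx_diag; congr (diag_mx _ *m _).
by apply/rowP => j; rewrite !mxE.
Qed.

Lemma mxfunD f g W D :
  mxfun f W D + mxfun g W D = mxfun (fun z => f z + g z) W D.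
Proof.
rewrite /mxfun -mulmxDl -mulmxDr -linearD; congr (_ *m diag_mx _ *m _).
by apply/rowP => j; rewrite !mxE.
Qed.

Lemma mxfunN f W D : - mxfun f W D = mxfun (fun z => - f z) W D.
Proof.
rewrite /mxfun -mulNmx -mulmxN -linearN; congr (_ *m diag_mx _ *m _).
by apply/rowP => j; rewrite !mxE.
Qed.

Lemma mxfunZ a f W D : a *: mxfun f W D = mxfun (fun z => a * f z) W D.
Proof.
rewrite /mxfun scalemxAl scalemxAr -linearZ; congr (_ *m diag_mx _ *m _).
by apply/rowP => j; rewrite !mxE.
Qed.

Lemma mxfun_adj f W D : (mxfun f W D) ^t* = mxfun (fun z => (f z)^*) W D.
Proof.
rewrite /mxfun !adjM trmxCK mulmxA tr_diag_mx map_diag_mx.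
by congr (_ *m diag_mx _ *m _); apply/rowP => j; rewrite !mxE.
Qed.

Lemma mxfun_conj f W D :
  cmx (mxfun f W D)
  = mxfun (fun z => (f z^*)^*) (cmx W) (cmx D).
Proof.
rewrite /mxfun !map_mxM -adj_conj map_diag_mx.
by congr (_ *m diag_mx _ *m _); apply/rowP => j; rewrite !mxE conjCK.
Qed.

Lemma mxfun1 W D : W \is unitarymx -> mxfun (fun=> 1) W D = 1%:M.
Proof.
move=> Wu; rewrite /mxfun.
have -> : map_mx (fun=> 1) D = const_mx 1 :> 'rV[C]_n.
  by apply/rowP => j; rewrite !mxE.
by rewrite diag_const_mx mulmx1 unitary_adjK.
Qed.

Lemma mxfun0 W D : mxfun (fun=> 0) W D = 0.
Proof.
rewrite /mxfun.
have -> : map_mx (fun=> 0) D = const_mx 0 :> 'rV[C]_n.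
  by apply/rowP => j; rewrite !mxE.
by rewrite diag_const_mx raddf0 mulmx0 mul0mx.
Qed.

Lemma mxtrace_mxfun f W D : W \is unitarymx ->
  \tr (mxfun f W D) = \sum_j f (D 0 j).
Proof.
move=> Wu; rewrite /mxfun mxtrace_mulC mulmxA (unitarymxP Wu) mul1mx.
by rewrite mxtrace_diag; apply: eq_bigr => j _; rewrite !mxE.
Qed.

Lemma det_mxfun f W D : W \is unitarymx ->
  \det (mxfun f W D) = \prod_j f (D 0 j).
Proof.
move=> Wu; rewrite /mxfun !det_mulmx mulrAC -det_mulmx unitary_adjK // det1.
by rewrite mul1r det_diag; apply: eq_bigr => j _; rewrite !mxE.
Qed.

(* An intertwiner only relates eigenvectors with the same eigenvalue. *)
Lemma mxfun_intertwine f W1 D1 W2 D2 V :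
  W1 \is unitarymx -> W2 \is unitarymx ->
  mxfun id W1 D1 *m V = V *m mxfun id W2 D2 ->
  mxfun f W1 D1 *m V = V *m mxfun f W2 D2.
Proof.
move=> W1u W2u.
(* In the two eigenbases the relation is entrywise: each entry of [M = W1 V W2^*] is either zero or
   sits between equal eigenvalues, which any [f] preserves. *)
have key g : (mxfun g W1 D1 *m V = V *m mxfun g W2 D2) <->
  diag_mx (map_mx g D1) *m (W1 *m V *m W2 ^t*)
  = (W1 *m V *m W2 ^t*) *m diag_mx (map_mx g D2).
  rewrite /mxfun; split=> [/(congr1 (fun X => W1 *m X *m W2 ^t*))|h].
    rewrite !mulmxA (unitarymxP W1u) mul1mx.
    by rewrite mulmxtVK.
  have := congr1 (fun X => W1 ^t* *m X *m W2) h.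
  by rewrite !mulmxA unitary_adjK // mul1mx mulmxKtV.
move=> /key h; apply/key; move: (W1 *m V *m _) h => M /matrixP h.
apply/matrixP => i j; have := h i j.
rewrite !mul_diag_mx !mul_mx_diag !mxE; set x := D1 0 i; set y := D2 0 j.
rewrite ![_ * M i j]mulrC => /eqP; rewrite -subr_eq0 -mulrBr mulf_eq0 subr_eq0.
by case/orP=> /eqP ->; rewrite ?mul0r.
Qed.

End FunctionalCalculus.

Lemma unitary_mxfun (C : numClosedFieldType) n (Z : 'M[C]_n) :
  Z \is unitarymx -> exists W D, [/\ W \is unitarymx, Z = mxfun id W D &
    forall j, D 0 j * (D 0 j)^* = 1].
Proof.
move=> Zu; have Zn : Z \is normalmx.
  by apply/normalmxP; rewrite unitary_adjK // (unitarymxP Zu).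
exists (spectralmx Z), (spectral_diag Z).
have Wu := spectral_unitarymx Z.
have E : Z = mxfun id (spectralmx Z) (spectral_diag Z).
  rewrite {1}(orthomx_spectralP Zn) invmx_unitary // /mxfun.
  by congr (_ *m diag_mx _ *m _); apply/rowP => j; rewrite !mxE.
split=> // j; move: E; set W := spectralmx Z in Wu *.
set D := spectral_diag Z => E.
have := unitarymxP Zu; rewrite E mxfun_adj mxfunM // /mxfun.
move=> /(congr1 (fun X => W *m X *m W ^t*)).
rewrite !mulmxA (unitarymxP Wu) mul1mx mulmx1 -mulmxA (unitarymxP Wu).
by rewrite mulmx1 => /matrixP /(_ j j); rewrite !mxE eqxx.
Qed.

(** * Splitting under an antiunitary operator *)

Section AntiunitarySplitting.
Variables (C : numClosedFieldType) (n : nat) (Q : 'M[C]_n).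
Hypotheses (Qu : Q \is unitarymx) (Qreal : cmx Q = Q).
Implicit Types (P : 'M[C]_n) (v : 'cV[C]_n).

(** The factor must be real so that scaling keeps a vector fixed by the conjugate-linear map
    [antiQ]. *)
Lemma normalize_cV v : v != 0 ->
  exists2 a : C, a^* = a & (a *: v) ^t* *m (a *: v) = 1%:M.
Proof.
move=> v0; set r := \sum_i (v i 0)^* * v i 0.
have r_ge0 : 0 <= r by apply: sumr_ge0 => i _; rewrite mulrC mul_conjC_ge0.
have r0 : r != 0.
  apply: contraNneq v0 => r0; apply/eqP/colP => i; rewrite !mxE.
  move: r0 => /eqP; rewrite psumr_eq0 => [/allP /(_ i)|k _].
    by rewrite mem_index_enum mulrC mul_conjC_eq0 => /(_ isT) /eqP.
  by rewrite mulrC mul_conjC_ge0.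
have sr_ge0 : 0 <= (sqrtC r)^-1 by rewrite invr_ge0 sqrtC_ge0.
have sa : ((sqrtC r)^-1)^* = (sqrtC r)^-1 by apply: CrealP; apply: ger0_real.
exists (sqrtC r)^-1 => //; apply/matrixP => i j; rewrite !ord1.
rewrite adjZ sa -scalemxAr -scalemxAl scalerA -expr2 exprVn sqrtCK !mxE /=.
rewrite -[X in _ * X]/(\sum_i _); under eq_bigr do rewrite !mxE.
by rewrite mulVf.
Qed.

(** The relation [X *m Q = Q *m cmx X], met throughout, says that [X] commutes with this
    conjugate-linear map. *)
Definition antiQ v := Q *m cmx v.

Lemma antiQK v : antiQ (antiQ v) = Q *m Q *m v.
Proof. by rewrite /antiQ map_mxM Qreal conjmxK mulmxA. Qed.

Lemma antiQ_dot u v : (antiQ u) ^t* *m antiQ v = cmx (u ^t* *m v).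
Proof.
rewrite /antiQ adjM mulmxA -[_ *m Q]mulmxA unitary_adjK // mulmx1.
by rewrite adj_conj map_mxM.
Qed.

Lemma antiQZ a v : antiQ (a *: v) = a^* *: antiQ v.
Proof. by rewrite /antiQ map_mxZ scalemxAr. Qed.

Lemma antiQD u v : antiQ (u + v) = antiQ u + antiQ v.
Proof. by rewrite /antiQ map_mxD mulmxDr. Qed.

Lemma antiQ_range P v : P *m Q = Q *m cmx P -> P *m v = v ->
  P *m antiQ v = antiQ v.
Proof. by move=> PQ Pv; rewrite /antiQ mulmxA PQ -mulmxA -map_mxM Pv. Qed.

Lemma projection_commutes_sqr P : P *m Q = Q *m cmx P ->
  P *m (Q *m Q) = Q *m Q *m P.
Proof.
move=> PQ; rewrite mulmxA PQ -!mulmxA; congr (_ *m _).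
by have := congr1 cmx PQ; rewrite !map_mxM Qreal conjmxK.
Qed.

(** On the range of [P] the map [antiQ] is an involution, so [w + antiQ w] is fixed. If this sum
    vanishes, [antiQ w = - w] and [i w] is fixed by conjugate-linearity. *)
Lemma antiQ_fixed_unit P : P != 0 -> P *m P = P -> P *m Q = Q *m cmx P ->
  Q *m Q *m P = P ->
  exists v, [/\ v ^t* *m v = 1%:M, P *m v = v & antiQ v = v].
Proof.
move=> P0 PP PQ QQP.
have [j wj0] : exists j, col j P != 0.
  apply/existsP; apply: contraNT P0; rewrite negb_exists => /forallP h.
  apply/eqP/matrixP => i j; have /eqP/colP/(_ i) := negbNE (h j).
  by rewrite !mxE.
set w := col j P in wj0.
have Pw : P *m w = w by rewrite /w colE mulmxA PP.
have ssw : antiQ (antiQ w) = w by rewrite antiQK -[in LHS]Pw mulmxA QQP.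
suff [u [u0 Pu su]] : exists u, [/\ u != 0, P *m u = u & antiQ u = u].
  have [a areal au] := normalize_cV u0.
  exists (a *: u); split=> //; first by rewrite -scalemxAr Pu.
  by rewrite antiQZ areal su.
have [sw|sw] := eqVneq (w + antiQ w) 0; last first.
  exists (w + antiQ w); split=> //; first by rewrite mulmxDr Pw antiQ_range.
  by rewrite antiQD ssw addrC.
exists ('i *: w); split; first by rewrite scaler_eq0 negb_or neq0Ci.
  by rewrite -scalemxAr Pw.
rewrite antiQZ conjCi; move/eqP: sw; rewrite addrC addr_eq0 => /eqP ->.
by rewrite scalerN scaleNr opprK.
Qed.

Lemma mxtrace_outer v : v ^t* *m v = 1%:M -> \tr (v *m v ^t*) = 1.
Proof. by move=> vv; rewrite mxtrace_mulC vv mxtrace1. Qed.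

(* If [Q Q v = mu v] with [mu <> 1] then [v] and [antiQ v] are orthogonal because
   [antiQ] is antiunitary.  If [Q Q = 1] on the range of [P] then [antiQ] is a complex
   conjugation there, and one takes [v = (a + i b) / sqrt 2] with [a] and [b] real. *)
Lemma splitting_vector P k : P ^t* = P -> P *m P = P -> P *m Q = Q *m cmx P ->
  \tr P = k.+2%:R ->
  exists v, [/\ v ^t* *m v = 1%:M, P *m v = v, (antiQ v) ^t* *m v = 0 &
    exists mu, Q *m Q *m v = mu *: v].
Proof.
move=> Pa PP PQ trP.
have QQu : Q *m Q \is unitarymx by apply: mul_unitarymx.
have PQQ := projection_commutes_sqr PQ.
have [QQP|QQP] := eqVneq (Q *m Q *m P) P.
  have P0 : P != 0.
    by apply/eqP => P0; move/eqP: trP; rewrite P0 mxtrace0 eq_sym pnatr_eq0.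
  have [a [aa Pax sa]] := antiQ_fixed_unit P0 PP PQ QQP.
  have a_P : a ^t* *m P = a ^t* by rewrite -[P]Pa -adjM Pax.
  pose P1 := P - a *m a ^t*.
  have P1P1 : P1 *m P1 = P1.
    rewrite /P1 mulmxBl !mulmxBr PP mulmxA Pax -(mulmxA a _ P) a_P.
    by rewrite mulmxA -(mulmxA a _ a) aa mulmx1 subrr subr0.
  (* The trace of [P] is at least 2, so a second fixed vector, orthogonal to [a], remains to be
     found. *)
  have P10 : P1 != 0.
    apply/eqP => /(congr1 mxtrace); rewrite /P1 linearB /= mxtrace_outer //.
    by rewrite trP mxtrace0 -natr1 addrK => /eqP; rewrite pnatr_eq0.
  have sa' : cmx a = Q ^t* *m a.
    by rewrite -{2}sa /antiQ mulmxA unitary_adjK // mul1mx.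
  have Qta : Q ^t* ^t* = Q by rewrite trmxCK.
  have P1Q : P1 *m Q = Q *m cmx P1.
    rewrite /P1 mulmxBl PQ map_mxB mulmxBr; congr (_ - _).
    rewrite map_mxM -adj_conj sa' adjM Qta !mulmxA.
    by rewrite (unitarymxP Qu) mul1mx.
  have PP1 : P *m P1 = P1 by rewrite /P1 mulmxBr PP mulmxA Pax.
  have QQP1 : Q *m Q *m P1 = P1 by rewrite -PP1 mulmxA QQP.
  have [b [bb P1b sb]] := antiQ_fixed_unit P10 P1P1 P1Q QQP1.
  have Pb : P *m b = b by rewrite -P1b mulmxA PP1.
  have ab : a ^t* *m b = 0.
    rewrite -P1b mulmxA /P1 mulmxBr a_P mulmxA aa mul1mx subrr mul0mx //.
  have ba : b ^t* *m a = 0 by rewrite -[LHS]trmxCK adjM trmxCK ab trmx0 map_mx0.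
  pose c : C := (sqrtC 2)^-1.
  have c_real : c^* = c.
    by apply: CrealP; apply: ger0_real; rewrite invr_ge0 sqrtC_ge0.
  have cc : c * c = 2^-1 by rewrite -expr2 exprVn sqrtCK.
  exists (c *: (a + 'i *: b)); split.
  - rewrite adjZ c_real adjD adjZ conjCi -scalemxAr -scalemxAl scalerA cc.
    rewrite mulmxDl !mulmxDr -!scalemxAr -!scalemxAl ab ba aa bb.
    rewrite !scaler0 !scalerA.
    rewrite addr0 add0r mulrN -expr2 sqrCi opprK scale1r.
    exact: scaler_half.
  - by rewrite -scalemxAr mulmxDr Pax -scalemxAr Pb.
  - rewrite antiQZ antiQD antiQZ sa sb conjCi c_real adjZ adjD adjZ rmorphN /=.
    rewrite conjCi opprK.
    rewrite c_real -scalemxAr -scalemxAl scalerA cc.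
    rewrite mulmxDl !mulmxDr -!scalemxAr -!scalemxAl ab ba aa bb.
    rewrite !scaler0 !scalerA.
    by rewrite addr0 add0r -expr2 sqrCi scaleN1r subrr scaler0.
  - exists 1; rewrite scale1r; set u := _ *: _.
    have Pu : P *m u = u by rewrite /u -scalemxAr mulmxDr Pax -scalemxAr Pb.
    by rewrite -[in LHS]Pu mulmxA QQP Pu.
have ss v : antiQ (antiQ v) = Q *m Q *m v := antiQK v.
move: (Q *m Q) QQu PQQ QQP ss => S Su PS SP ss.
have SKl A : S ^t* *m (S *m A) = A :> 'M[C]_n.
  by rewrite mulmxA unitary_adjK // mul1mx.
have NN : S *m P \is normalmx.
  apply/normalmxP; rewrite adjM Pa mulmxA -(mulmxA _ P P) PP -PS mulmxtVK //.
  by rewrite PS -mulmxA SKl PP.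
have Wu := spectral_unitarymx (S *m P).
have := orthomx_spectralP NN; rewrite invmx_unitary //.
move: (spectralmx _) (spectral_diag _) Wu => W D Wu SPE.
(* If [S *m P] had only the eigenvalues 0 and 1 it would be idempotent, and cancelling the unitary
   [S] would give [S *m P = P]. *)
have [j /andP[D0 D1]] : exists j, (D 0 j != 0) && (D 0 j != 1).
  apply/existsP; apply: contraNT SP; rewrite negb_exists => /forallP h.
  have SPSP : S *m P *m (S *m P) = S *m P.
    rewrite SPE !mulmxA mulmxtVK // -[_ *m diag_mx D *m diag_mx D]mulmxA.
    rewrite mulmx_diag; congr (_ *m diag_mx _ *m _); apply/rowP => j.
    rewrite !mxE; move: (h j); rewrite negb_and !negbK.
    by case/orP=> /eqP ->; rewrite ?mulr0 ?mulr1.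
  have SSP : S *m (S *m P) = S *m P.
    by rewrite -{2}SPSP -mulmxA [P *m _]mulmxA PS -[_ *m P *m P]mulmxA PP.
  by apply/eqP; rewrite -[LHS]SKl SSP SKl.
pose v := W ^t* *m (delta_mx j 0 : 'cV[C]_n).
have SPv : S *m P *m v = D 0 j *: v.
  rewrite SPE /v mulmxA mulmxtVK // -mulmxA mul_diag_mx scalemxAr.
  congr (_ *m _); apply/matrixP => i i'; rewrite !mxE.
  by have [->|] := eqVneq i j; rewrite /= ?mulr0.
have Pv : P *m v = v.
  apply: (scalerI D0); rewrite scalemxAr -SPv !mulmxA.
  by rewrite -[P *m S *m P]mulmxA -PS mulmxA PP PS.
have Sv : S *m v = D 0 j *: v by rewrite -SPv -mulmxA Pv.
exists v; split=> //; last by exists (D 0 j).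
  rewrite /v adjM trmxCK mulmxA mulmxtVK // trmx_delta map_delta_mx /=.
  by rewrite mul_delta_mx; apply/matrixP => i i'; rewrite !ord1 !mxE.
(* With [s = antiQ] and [S = s s], antiunitarity makes the product of [s v] with [S v] the conjugate
   of that of [v] with [s v], hence the product of [s v] with [v]. *)
have e : D 0 j *: ((antiQ v) ^t* *m v) = (antiQ v) ^t* *m v.
  have h1 (A : 'M[C]_1) : A^T = A by apply/matrixP => i i'; rewrite !ord1 !mxE.
  have E : (v ^t* *m antiQ v) ^t* = (antiQ v) ^t* *m v by rewrite adjM trmxCK.
  by rewrite scalemxAr -Sv -ss antiQ_dot -E h1.
have : (D 0 j - 1) *: ((antiQ v) ^t* *m v) = 0 by rewrite scalerBl e scale1r subrr.
by move/eqP; rewrite scaler_eq0 subr_eq0 (negPf D1) => /eqP.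
Qed.

(** The last relation says that [antiQ] exchanges the eigenspaces of [H] for 1 and -1. The induction
    splits off the plane spanned by a splitting vector [v] and [w = antiQ v], on which [H] is
    [v v^* - w w^*]. *)
Lemma splitting_involution k P :
  P ^t* = P -> P *m P = P -> P *m Q = Q *m cmx P -> \tr P = k.*2%:R ->
  exists H : 'M[C]_n,
    [/\ H ^t* = H, H *m H = P, P *m H = H & H *m Q = - (Q *m cmx H)].
Proof.
elim: k P => [|k IH] P Pa PP PQ trP.
  have P0 : P = 0 by apply: mxtrace_adj_eq0; rewrite Pa PP.
  exists 0; rewrite P0 !mulmx0 !mul0mx map_mx0 mulmx0 trmx0 map_mx0 oppr0.
  by split.
rewrite doubleS in trP; have [v [vv Pv wv [mu Sv]]] := splitting_vector Pa PP PQ trP.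
have [w wE] : exists w, w = antiQ v by exists (antiQ v).
rewrite -wE in wv.
have ww : w ^t* *m w = 1%:M by rewrite wE antiQ_dot vv map_mx1.
have vw : v ^t* *m w = 0 by rewrite -[LHS]trmxCK adjM trmxCK wv trmx0 map_mx0.
have Pw : P *m w = w by rewrite wE; apply: antiQ_range.
pose P' := P - v *m v ^t* - w *m w ^t*.
have vP : v ^t* *m P = v ^t* by rewrite -[P]Pa -adjM Pv.
have wP : w ^t* *m P = w ^t* by rewrite -[P]Pa -adjM Pw.
have QQu : Q *m Q \is unitarymx by apply: mul_unitarymx.
have mu1 : mu^* * mu = 1.
  have : (mu *: v) ^t* *m (mu *: v) = 1%:M.
    by rewrite -Sv adjM mulmxA mulmxKtV.
  rewrite adjZ -scalemxAr -scalemxAl vv scalerA => /matrixP /(_ 0 0).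
  by rewrite !mxE eqxx mulr1 mulrC.
have vS : v ^t* *m (Q *m Q) = mu *: v ^t*.
  have : v ^t* = mu^* *: (v ^t* *m (Q *m Q)).
    by rewrite scalemxAl -adjZ -Sv adjM mulmxKtV.
  by move=> {2}->; rewrite scalerA mulrC mu1 scale1r.
have wwQ : w *m w ^t* *m Q = Q *m cmx (v *m v ^t*).
  by rewrite wE /antiQ adjM !mulmxA mulmxKtV // map_mxM -adj_conj mulmxA.
(* Since [antiQ w = mu v] with [mu] of modulus 1, [antiQ] sends the line of [w] back to the line of
   [v]. *)
have vvQ : v *m v ^t* *m Q = Q *m cmx (w *m w ^t*).
  rewrite wE /antiQ map_mxM -adj_conj map_mxM Qreal conjmxK adjM !mulmxA Sv.
  by rewrite -scalemxAl scalemxAr -vS !mulmxA mulmxtVK.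
have P'v : P' *m v = 0.
  by rewrite /P' !mulmxBl Pv -!mulmxA vv wv mulmx1 mulmx0 subr0 subrr.
have P'w : P' *m w = 0.
  by rewrite /P' !mulmxBl Pw -!mulmxA ww vw mulmx1 mulmx0 subr0 subrr.
have P'a : P' ^t* = P' by rewrite /P' !(adjD, adjN) !adjM !trmxCK Pa.
have P'P' : P' *m P' = P'.
  rewrite {2}/P' !mulmxBr !mulmxA P'v P'w !mul0mx !subr0.
  by rewrite /P' !mulmxBl PP -!mulmxA vP wP.
have P'Q : P' *m Q = Q *m cmx P'.
  rewrite /P' !mulmxBl !map_mxB !mulmxBr PQ vvQ wwQ.
  by rewrite -!addrA [- _ - _]addrC.
have trP' : \tr P' = k.*2%:R.
  rewrite /P' !linearB /= !mxtrace_outer // trP -!natr1.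
  by rewrite !addrK.
have [H [Ha HH PH HQ]] := IH P' P'a P'P' P'Q trP'.
have Hv : H *m v = 0.
  by rewrite -Ha -PH adjM P'a -mulmxA P'v mulmx0.
have Hw : H *m w = 0.
  by rewrite -Ha -PH adjM P'a -mulmxA P'w mulmx0.
have vH : v ^t* *m H = 0 by rewrite -[LHS]trmxCK adjM trmxCK Ha Hv trmx0 map_mx0.
have wH : w ^t* *m H = 0 by rewrite -[LHS]trmxCK adjM trmxCK Ha Hw trmx0 map_mx0.
exists (H + v *m v ^t* - w *m w ^t*); split.
- by rewrite !(adjD, adjN) !adjM !trmxCK Ha.
- have outerM (x y z t : 'cV[C]_n) :
    x *m y ^t* *m (z *m t ^t*) = x *m (y ^t* *m z) *m t ^t*.
    by rewrite !mulmxA.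
  rewrite !(mulmxDl, mulmxDr, mulNmx, mulmxN) HH !outerM vv ww vw wv.
  rewrite !(mulmxA H) Hv Hw -!mulmxA vH wH !(mul0mx, mulmx0, mul1mx).
  by rewrite !(oppr0, addr0, add0r) opprK /P' [X in X + _]addrAC !subrK.
- rewrite !(mulmxDr, mulmxN) !mulmxA Pv Pw; congr (_ + _ - _).
  have PP' : P *m P' = P' by rewrite /P' !mulmxBr PP !mulmxA Pv Pw.
  by rewrite -PH mulmxA PP'.
- rewrite !(mulmxDl, mulNmx) HQ vvQ wwQ !(map_mxD, map_mxN) !(mulmxDr, mulmxN).
  by rewrite !opprD opprK -!addrA [X in _ + X]addrC.
Qed.
End AntiunitarySplitting.

Lemma conjC_eqN1 (C : numClosedFieldType) (z : C) : (z^* == -1) = (z == -1).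
Proof. by rewrite -(can_eq conjCK) conjCK rmorphN rmorph1. Qed.

(** * Functional calculus with a split eigenspace for -1 *)

Section SplitCalculus.
Variables (C : numClosedFieldType) (n : nat).
Variables (W : 'M[C]_n) (D : 'rV[C]_n).
Hypothesis Wu : W \is unitarymx.

Definition proj_opp1 : 'M[C]_n := mxfun (fun z => (z == -1)%:R) W D.

Definition splits_proj (P Pp Pm : 'M[C]_n) : Prop :=
  [/\ Pp ^t* = Pp /\ Pm ^t* = Pm, Pp *m Pp = Pp /\ Pm *m Pm = Pm,
      Pp *m Pm = 0 /\ Pm *m Pp = 0 & Pp + Pm = P].

Lemma proj_opp1_adj : proj_opp1 ^t* = proj_opp1.
Proof. by rewrite mxfun_adj; apply: eq_mxfun => j; rewrite conjC_nat. Qed.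

Lemma proj_opp1_idem : proj_opp1 *m proj_opp1 = proj_opp1.
Proof.
by rewrite mxfunM //; apply: eq_mxfun => j; rewrite -natrM mulnb andbb.
Qed.

(** The splitting used for the commutant of [V], where the whole eigenspace can be rotated by
    [pi]. *)
Lemma splits_proj_opp1_0 : splits_proj proj_opp1 proj_opp1 0.
Proof.
split; rewrite ?addr0 //; split; rewrite ?mulmx0 ?mul0mx ?trmx0 ?map_mx0 //.
  exact: proj_opp1_adj.
exact: proj_opp1_idem.
Qed.

Variables Pp Pm : 'M[C]_n.
Hypothesis split_P : splits_proj proj_opp1 Pp Pm.

(* [f Z] outside the eigenspace of [-1], [a] on the range of [Pp], and [b] on the
   range of [Pm]. *)
Definition splitfun (f : C -> C) (a b : C) : 'M[C]_n :=
  mxfun (fun z => if z == -1 then 0 else f z) W D + a *: Pp + b *: Pm.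

Let off f : 'M[C]_n := mxfun (fun z => if z == -1 then 0 else f z) W D.

Let offP f : off f *m proj_opp1 = 0.
Proof.
rewrite mxfunM // -(mxfun0 W D); apply: eq_mxfun => j.
by case: eqP; rewrite ?mul0r ?mulr0.
Qed.

Let Poff f : proj_opp1 *m off f = 0.
Proof.
rewrite mxfunM // -(mxfun0 W D); apply: eq_mxfun => j.
by case: eqP; rewrite ?mul0r ?mulr0.
Qed.

Let zeros f : (off f *m Pp = 0 /\ off f *m Pm = 0) /\
  (Pp *m off f = 0 /\ Pm *m off f = 0).
Proof.
have [_ [pp mm] [pm mp] PE] := split_P.
have e1 : proj_opp1 *m Pp = Pp by rewrite -PE mulmxDl pp mp addr0.
have e2 : proj_opp1 *m Pm = Pm by rewrite -PE mulmxDl mm pm add0r.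
have e3 : Pp *m proj_opp1 = Pp by rewrite -PE mulmxDr pp pm addr0.
have e4 : Pm *m proj_opp1 = Pm by rewrite -PE mulmxDr mm mp add0r.
split; split.
- by rewrite -e1 mulmxA offP mul0mx.
- by rewrite -e2 mulmxA offP mul0mx.
- by rewrite -e3 -mulmxA Poff mulmx0.
- by rewrite -e4 -mulmxA Poff mulmx0.
Qed.

Lemma eq_splitfun f g a b : (forall j, D 0 j != -1 -> f (D 0 j) = g (D 0 j)) ->
  splitfun f a b = splitfun g a b.
Proof.
move=> fg; congr (_ + _ + _); apply: eq_mxfun => j.
by case: eqP => [//|/eqP]; exact: fg.
Qed.

Lemma splitfunM f g a b c d :
  splitfun f a b *m splitfun g c d
  = splitfun (fun z => f z * g z) (a * c) (b * d).
Proof.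
rewrite /splitfun -!/(off _).
have [[fp fm] [pf mf]] := zeros f; have [[gp gm] [pg mg]] := zeros g.
have [_ [pp mm] [pm mp] _] := split_P.
rewrite !mulmxDl !mulmxDr -!scalemxAl -!scalemxAr fp fm pg mg pp mm pm mp.
rewrite !scaler0 !addr0 !add0r !scalerA; congr (_ + _ + _).
by rewrite mxfunM //; apply: eq_mxfun => j; case: eqP; rewrite ?mul0r.
Qed.

Lemma splitfun_adj f a b :
  (splitfun f a b) ^t* = splitfun (fun z => (f z)^*) a^* b^*.
Proof.
have [[pa ma] _ _ _] := split_P.
rewrite /splitfun !adjD !adjZ pa ma mxfun_adj; congr (_ + _ + _).
by apply: eq_mxfun => j; case: eqP; rewrite ?conjC0.
Qed.

Lemma splitfun1 : splitfun (fun=> 1) 1 1 = 1%:M.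
Proof.
have [_ _ _ PE] := split_P.
rewrite /splitfun !scale1r -addrA PE /proj_opp1 mxfunD -(mxfun1 D Wu).
by apply: eq_mxfun => j; case: eqP; rewrite ?addr0 ?add0r.
Qed.

Lemma splitfun_id : splitfun id (-1) (-1) = mxfun id W D.
Proof.
have [_ _ _ PE] := split_P.
rewrite /splitfun -addrA -scalerDr PE /proj_opp1 mxfunZ mxfunD.
by apply: eq_mxfun => j; case: eqP => [->|_]; rewrite ?mulr1 ?mulr0 ?add0r ?addr0.
Qed.

Lemma mxtrace_splitfun f a :
  \tr (splitfun f a a) = \sum_j (if D 0 j == -1 then a else f (D 0 j)).
Proof.
have [_ _ _ PE] := split_P.
rewrite /splitfun -addrA -scalerDr PE /proj_opp1 mxfunZ mxfunD mxtrace_mxfun //.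
by apply: eq_bigr => j _; case: eqP; rewrite ?mulr1 ?mulr0 ?add0r ?addr0.
Qed.

(** With the trivial splitting, [splitfun] is a genuine function of [Z] and commutes with whatever
    commutes with [Z]. *)
Lemma splitfun_comm f a b V : Pm = 0 -> mxfun id W D *m V = V *m mxfun id W D ->
  splitfun f a b *m V = V *m splitfun f a b.
Proof.
move=> Pm0 ZV; have [_ _ _ PE] := split_P.
rewrite /splitfun Pm0 scaler0 addr0 (_ : Pp = proj_opp1); last first.
  by rewrite -PE Pm0 addr0.
by rewrite mxfunZ mxfunD; exact: mxfun_intertwine.
Qed.

(** [Q] intertwines [Z] with its conjugate, which [cmx W] diagonalizes with conjugate eigenvalues.
    When [f] commutes with conjugation on the spectrum, the conjugate of [f Z] is [f] of the
    conjugate of [Z]. *)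
Lemma mxfun_twisted f Q : mxfun id W D *m Q = Q *m cmx (mxfun id W D) ->
  (forall j, f (D 0 j)^* = (f (D 0 j))^*) ->
  mxfun f W D *m Q = Q *m cmx (mxfun f W D).
Proof.
move=> ZQ fJ; have Wcu : cmx W \is unitarymx by rewrite conjC_unitary.
have -> : cmx (mxfun f W D) = mxfun f (cmx W) (cmx D).
  by rewrite mxfun_conj; apply: eq_mxfun => j; rewrite !mxE conjCK fJ.
apply: mxfun_intertwine => //; rewrite ZQ mxfun_conj; congr (_ *m _).
by apply: eq_mxfun => j; rewrite conjCK.
Qed.

(** The two halves are exchanged by a conjugate-linear map, so the scalars on them have to be
    conjugate to each other. *)
Lemma splitfun_twisted f a Q :
  mxfun id W D *m Q = Q *m cmx (mxfun id W D) ->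
  Pp *m Q = Q *m cmx Pm ->
  (forall j, D 0 j != -1 -> f (D 0 j)^* = (f (D 0 j))^*) ->
  splitfun f a a^* *m Q = Q *m cmx (splitfun f a a^*).
Proof.
move=> ZQ pQ fJ; have [_ _ _ PE] := split_P.
have PQ : proj_opp1 *m Q = Q *m cmx proj_opp1.
  by apply: mxfun_twisted => // j; rewrite conjC_nat conjC_eqN1.
have mQ : Pm *m Q = Q *m cmx Pp.
  move: PQ; rewrite -PE mulmxDl map_mxD mulmxDr pQ addrC => /eqP.
  by rewrite (inj_eq (addIr _)) => /eqP.
have fQ : off f *m Q = Q *m cmx (off f).
  apply: mxfun_twisted => // j; rewrite conjC_eqN1.
  by case: eqP => [_|/eqP /fJ //]; rewrite conjC0.
rewrite /splitfun -!/(off _) !mulmxDl !map_mxD !map_mxZ !mulmxDr -!scalemxAl.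
by rewrite -!scalemxAr fQ pQ mQ /= conjCK addrAC.
Qed.

End SplitCalculus.

(** On the range of [P], [H] is a self-adjoint involution, and the two matrices are its
    eigenprojections for 1 and -1. *)
Lemma involution_splits (C : numClosedFieldType) n (P H : 'M[C]_n) :
  P ^t* = P -> P *m P = P -> H ^t* = H -> H *m H = P -> P *m H = H ->
  splits_proj P (2^-1 *: (P + H)) (2^-1 *: (P - H)).
Proof.
move=> Pa PP Ha HH PH.
have HP : H *m P = H by rewrite -Ha -[P in LHS]Pa -adjM PH.
have h2 : (2^-1 : C)^* = 2^-1 by rewrite fmorphV /= conjC_nat.
have half (X : 'M[C]_n) : (2^-1 * 2^-1) *: (X + X) = 2^-1 *: X.
  by rewrite -scalerA scaler_half.
split; [split|split|split|].
- by rewrite adjZ adjD Pa Ha h2.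
- by rewrite adjZ adjD adjN Pa Ha h2.
- rewrite -scalemxAl -scalemxAr scalerA mulmxDl !mulmxDr PP HH HP PH.
  by rewrite [H + P]addrC half.
- rewrite -scalemxAl -scalemxAr scalerA mulmxBl !mulmxBr PP HH HP PH.
  by rewrite opprB half.
- rewrite -scalemxAl -scalemxAr scalerA mulmxDl !mulmxBr PP HH HP PH.
  by rewrite addrA subrK subrr scaler0.
- rewrite -scalemxAl -scalemxAr scalerA mulmxBl !mulmxDr PP HH HP PH.
  by rewrite [H + P]addrC subrr scaler0.
by rewrite -scalerDr addrCA addrK scaler_half.
Qed.

Lemma unitary_quotient (C : numClosedFieldType) n (X Y : 'M[C]_n) :
  X \is unitarymx -> Y \is unitarymx ->
  X ^t* *m Y \is unitarymx /\ X *m (X ^t* *m Y) = Y.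
Proof.
move=> Xu Yu; split; first by rewrite mul_unitarymx ?trmxC_unitary.
by rewrite mulmxA (unitarymxP Xu) mul1mx.
Qed.

Lemma det_unitary_quotient (C : numClosedFieldType) n (X Y : 'M[C]_n) :
  \det X = 1 -> \det Y = 1 -> \det (X ^t* *m Y) = 1.
Proof. by move=> dX dY; rewrite det_mulmx det_adj dX dY rmorph1 mulr1. Qed.

Lemma commutant_mul (C : numClosedFieldType) n (V X Y : 'M[C]_n) :
  X *m V = V *m X -> Y *m V = V *m Y -> X *m Y *m V = V *m (X *m Y).
Proof. by move=> XV YV; rewrite -mulmxA YV mulmxA XV -mulmxA. Qed.

Lemma commutant_quotient (C : numClosedFieldType) n (V X Y : 'M[C]_n) :
  X \is unitarymx -> X *m V = V *m X -> Y *m V = V *m Y ->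
  X ^t* *m Y *m V = V *m (X ^t* *m Y).
Proof.
move=> Xu XV YV.
have XaV : X ^t* *m V = V *m X ^t*.
  have := congr1 (fun A => X ^t* *m A *m X ^t*) XV.
  by rewrite !mulmxA unitary_adjK // mul1mx mulmxtVK // => ->.
by rewrite -mulmxA YV !mulmxA XaV.
Qed.

Lemma twisted_quotient (C : numClosedFieldType) n (Q X Y : 'M[C]_n) :
  X \is unitarymx -> X *m Q = Q *m cmx X -> Y *m Q = Q *m cmx Y ->
  X ^t* *m Y *m Q = Q *m cmx (X ^t* *m Y).
Proof.
move=> Xu XQ YQ.
have Xcu : cmx X \is unitarymx by rewrite conjC_unitary.
have XaQ : X ^t* *m Q = Q *m cmx (X ^t*).
  have := congr1 (fun A => X ^t* *m A *m (cmx X) ^t*) XQ.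
  by rewrite !mulmxA unitary_adjK // mul1mx mulmxtVK // adj_conj => ->.
by rewrite -mulmxA YQ !mulmxA XaQ map_mxM mulmxA.
Qed.

Lemma twisted_mul (C : numClosedFieldType) n (Q X Y : 'M[C]_n) :
  X *m Q = Q *m cmx X -> Y *m Q = Q *m cmx Y ->
  X *m Y *m Q = Q *m cmx (X *m Y).
Proof. by move=> XQ YQ; rewrite -mulmxA YQ mulmxA XQ -mulmxA map_mxM. Qed.

(** * Determinants and eigenvalues in the twisted commutant *)

Section Twisted.
Variables (C : numClosedFieldType) (n : nat) (Q : 'M[C]_n).
Hypotheses (Qu : Q \is unitarymx) (Qreal : cmx Q = Q).

Lemma det_twisted_real X : X *m Q = Q *m cmx X -> (\det X)^* = \det X.
Proof.
move=> /(congr1 determinant); rewrite !det_mulmx det_map_mx mulrC => /mulfI h.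
by apply/esym/h; have := unitarymx_unit Qu; rewrite unitmxE unitfE.
Qed.

Lemma unitary_twisted_det_sqr X : X \is unitarymx -> X *m Q = Q *m cmx X ->
  \det X ^+ 2 = 1.
Proof.
move=> /unitarymxP /(congr1 determinant) + /det_twisted_real XJ.
by rewrite det_mulmx det_adj XJ det1.
Qed.

(** From [1 - Z = Z (Z - 1)^*], [det Z = 1] and the reality of [det (Z - 1)] one gets
    [det (1 - Z) = det (Z - 1)]. In odd dimension these are also opposite, so both vanish. *)
Lemma twisted_eigenvalue1 W D :
  W \is unitarymx -> mxfun id W D \is unitarymx -> \det (mxfun id W D) = 1 ->
  mxfun id W D *m Q = Q *m cmx (mxfun id W D) -> odd n ->
  exists j, D 0 j = 1.
Proof.
move=> Wu; set Z := mxfun id W D => Zu dZ ZQ n_odd.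
have dJ : (\det (Z - 1%:M))^* = \det (Z - 1%:M).
  apply: det_twisted_real.
  by rewrite mulmxBl ZQ map_mxB map_mx1 mulmxBr mulmx1 mul1mx.
have : \det (1%:M - Z) = \det (Z - 1%:M).
  have -> : 1%:M - Z = Z *m (Z - 1%:M) ^t*.
    by rewrite adjD adjN adj1 mulmxBr mulmx1 (unitarymxP Zu).
  by rewrite det_mulmx dZ mul1r det_adj dJ.
rewrite -opprB -scaleN1r detZ -signr_odd n_odd expr1 mulN1r => /eqP.
rewrite eqNr -(mxfun1 D Wu) /Z mxfunN mxfunD det_mxfun // => /eqP/esym/eqP.
rewrite eq_sym => /prodf_eq0 [j _]; rewrite subr_eq0 => /eqP.
by exists j.
Qed.

(* Replacing [-1] by [1] in [Z] gives a matrix of determinant 1, since it is the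
   square of a matrix in the twisted commutant, whose determinant is [1] or [-1]. *)
Lemma twisted_opp1_parity W D :
  W \is unitarymx -> \det (mxfun id W D) = 1 ->
  (forall j, D 0 j * (D 0 j)^* = 1) ->
  mxfun id W D *m Q = Q *m cmx (mxfun id W D) ->
  ~~ odd #|[pred j | D 0 j == -1]|.
Proof.
move=> Wu dZ D1 ZQ.
(* For a unit [z] other than -1, [(1 + z) / |1 + z|] is the square root in the right half-plane, a
   choice that commutes with conjugation. *)
pose r (z : C) := if z == -1 then 1 else (1 + z) / `|1 + z|.
have normJ (z : C) : `|1 + z^*| = `|1 + z|.
  by rewrite -norm_conjC rmorphD rmorph1 /= conjCK.
have r_conj z : r z^* = (r z)^*.
  rewrite /r conjC_eqN1; case: eqP => _; first by rewrite rmorph1.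
  by rewrite rmorphM rmorphD rmorph1 fmorphV /= (conj_Creal (normr_real _))
    normJ.
have r_sqr z : z * z^* = 1 -> r z ^+ 2 = if z == -1 then 1 else z.
  move=> zz; rewrite /r; case: eqP => [_|/eqP zN1]; first by rewrite expr1n.
  have z1 : 1 + z^* != 0 by rewrite addrC addr_eq0 conjC_eqN1.
  have z2 : 1 + z != 0 by rewrite addrC addr_eq0.
  rewrite expr_div_n normCK rmorphD rmorph1 /= expr2 -mulf_div divff // mul1r.
  apply: (canLR (mulfK z1)); rewrite mulrDr mulr1 zz addrC //.
have rQ := mxfun_twisted Wu ZQ (fun j => r_conj (D 0 j)).
have ru : mxfun r W D \is unitarymx.
  apply/unitarymxP; rewrite mxfun_adj mxfunM // -(mxfun1 D Wu).
  apply: eq_mxfun => j; rewrite -r_conj.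
  rewrite /r conjC_eqN1; case: eqP => [_|/eqP zN1]; first by rewrite mulr1.
  have z2 : 1 + D 0 j != 0 by rewrite addrC addr_eq0.
  have z1 : 1 + (D 0 j)^* != 0 by rewrite addrC addr_eq0 conjC_eqN1.
  by rewrite normJ mulf_div -expr2 normCK rmorphD rmorph1 divff // mulf_neq0.
have := unitary_twisted_det_sqr ru rQ.
rewrite det_mxfun // -prodrXl => h1.
(* The numbers [r z ^+ 2] are the eigenvalues with each -1 replaced by 1, and their product is 1;
   the product of all eigenvalues is therefore the sign contributed by -1. *)
have : \prod_j D 0 j = (-1) ^+ #|[pred j | D 0 j == -1]|.
  rewrite (bigID (fun j => D 0 j == -1)) /=.
  rewrite (eq_bigr (fun=> -1)) => [|j /eqP //]; rewrite prodr_const.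
  move: h1; rewrite (bigID (fun j => D 0 j == -1)) /=.
  rewrite big1 => [|j /eqP Dj]; last by rewrite /r Dj eqxx expr1n.
  rewrite mul1r (eq_bigr (fun j => D 0 j)) => [-> |j Dj]; first by rewrite mulr1.
  by rewrite r_sqr // (negPf Dj).
rewrite -(det_mxfun id D Wu) dZ -signr_odd; case: odd => //= /eqP.
by rewrite expr1 -addr_eq0 -mulr2n pnatr_eq0.
Qed.

Lemma twisted_splits W D :
  W \is unitarymx -> \det (mxfun id W D) = 1 ->
  (forall j, D 0 j * (D 0 j)^* = 1) ->
  mxfun id W D *m Q = Q *m cmx (mxfun id W D) ->
  exists Pp Pm, splits_proj (proj_opp1 W D) Pp Pm /\ Pp *m Q = Q *m cmx Pm.
Proof.
move=> Wu dZ D1 ZQ.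
have Pa := proj_opp1_adj W D.
have PP := proj_opp1_idem D Wu.
have PQ : proj_opp1 W D *m Q = Q *m cmx (proj_opp1 W D).
  by apply: mxfun_twisted => // j; rewrite conjC_nat conjC_eqN1.
have [H [Ha HH PH HQ]] : exists H : 'M[C]_n, [/\ H ^t* = H,
    H *m H = proj_opp1 W D, proj_opp1 W D *m H = H & H *m Q = - (Q *m cmx H)].
  apply: (splitting_involution Qu Qreal (k := #|[pred j | D 0 j == -1]|./2)) => //.
  rewrite even_halfK; last exact: twisted_opp1_parity ZQ.
  rewrite mxtrace_mxfun // -sum1_card natr_sum [RHS]big_mkcond /=.
  by apply: eq_bigr => j _; rewrite inE; case: (D 0 j == -1).
exists (2^-1 *: (proj_opp1 W D + H)), (2^-1 *: (proj_opp1 W D - H)).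
split; first exact: involution_splits.
rewrite map_mxZ map_mxB fmorphV /= conjC_nat -scalemxAl -scalemxAr; congr (_ *: _).
by rewrite mulmxDl mulmxBr PQ HQ.
Qed.

End Twisted.

(** * A real line invariant under an orthogonal matrix of odd order *)

Section InvariantLine.
Variables (R : realFieldType) (n : nat) (Q : 'M[R]_n).
Hypotheses (QO : Q *m Q^T = 1%:M) (n_odd : odd n).

(** The eigenvalue is [e = det Q], with [e^2 = 1]. Since [Q - e = - e Q (Q - e)^T] and
    [det (- e Q) = -1] for odd [n], [det (Q - e)] equals its opposite. The eigenvector on both sides
    makes the projection onto its line commute with [Q]. *)
Lemma orthogonal_eigenvector :
  exists e (v : 'rV[R]_n), [/\ v != 0, v *m Q = e *: v & Q *m v^T = e *: v^T].
Proof.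
have QTO : Q^T *m Q = 1%:M by exact: mulmx1C.
pose e := \det Q.
have ee : e * e = 1 by have := congr1 determinant QO; rewrite det_mulmx det_tr det1.
have en : e ^+ n = e.
  rewrite -[n]odd_double_half n_odd exprD expr1 -mul2n exprM expr2 ee expr1n.
  by rewrite mulr1.
have QE : Q - e%:M = - (e *: Q) *m (Q - e%:M)^T.
  rewrite linearB /= tr_scalar_mx mulmxBr mulNmx -scalemxAl QO mulNmx.
  by rewrite mul_mx_scalar scalerA ee scale1r opprK scalemx1 addrC.
have : \det (Q - e%:M) == 0.
  have := congr1 determinant QE; rewrite det_mulmx det_tr -scalerN detZ.
  rewrite -[- Q]scaleN1r detZ -signr_odd n_odd expr1 -/e en mulN1r mulrN ee.
  by rewrite mulN1r => /eqP; rewrite -addr_eq0 -mulr2n mulrn_eq0.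
case/det0P => v v0 /eqP; rewrite mulmxBr subr_eq0 mul_mx_scalar => /eqP vQ.
exists e, v; split=> //.
have := congr1 (fun x => e *: (x *m Q^T)) vQ; rewrite -mulmxA QO mulmx1.
rewrite -scalemxAl scalerA ee scale1r => /(congr1 trmx).
by rewrite trmx_mul trmxK linearZ.
Qed.

Lemma orthogonal_invariant_line : exists P : 'M[R]_n,
  [/\ P^T = P, P *m P = P, \tr P = 1 & P *m Q = Q *m P].
Proof.
have [e [v [v0 vQ Qv]]] := orthogonal_eigenvector.
pose r := (v *m v^T) 0 0.
have vv : v *m v^T = r%:M by apply/matrixP => i j; rewrite !ord1 [RHS]mxE eqxx.
have r0 : r != 0.
  apply: contraNneq v0 => r0; apply/eqP/rowP => i.
  move: r0; rewrite /r mxE => /eqP; rewrite psumr_eq0 => [/allP /(_ i)|k _].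
    by rewrite mem_index_enum !mxE -expr2 sqrf_eq0 => /(_ isT) /eqP.
  by rewrite !mxE -expr2 sqr_ge0.
exists (r^-1 *: (v^T *m v)); split.
- by rewrite linearZ /= trmx_mul trmxK.
- rewrite -scalemxAl -scalemxAr mulmxA -[v^T *m v *m v^T]mulmxA vv.
  by rewrite mul_mx_scalar -scalemxAl !scalerA; congr (_ *: _); field.
- by rewrite linearZ /= mxtrace_mulC vv mxtrace_scalar mulr1n mulVf.
- by rewrite -scalemxAl -scalemxAr -mulmxA vQ mulmxA Qv -scalemxAl scalemxAr.
Qed.

End InvariantLine.

Lemma projection_mxfun (C : numClosedFieldType) n (P : 'M[C]_n) :
  P ^t* = P -> P *m P = P -> exists W D, [/\ W \is unitarymx,
    P = mxfun id W D & forall j, D 0 j = (D 0 j == 1)%:R].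
Proof.
move=> Pa PP; have Pn : P \is normalmx by apply/normalmxP; rewrite Pa.
have Wu := spectral_unitarymx P.
have := orthomx_spectralP Pn; rewrite invmx_unitary //.
move: (spectralmx _) (spectral_diag _) Wu => W D Wu PE.
have Pfun : P = mxfun id W D.
  rewrite {1}PE /mxfun; congr (_ *m diag_mx _ *m _).
  by apply/rowP => j; rewrite !mxE.
exists W, D; split=> // j.
have := congr1 (fun X => W *m X *m W ^t*) PP; rewrite Pfun mxfunM // /mxfun.
rewrite !mulmxA (unitarymxP Wu) !mul1mx -![_ *m W *m W ^t*]mulmxA.
rewrite (unitarymxP Wu) !mulmx1 => /matrixP /(_ j j).
rewrite !mxE eqxx !mulr1n => /eqP; rewrite -subr_eq0 -{3}[D 0 j]mulr1 -mulrBr.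
by rewrite mulf_eq0 subr_eq0 => /orP[]/eqP ->; rewrite ?eqxx // eq_sym oner_eq0.
Qed.

(** A trace-one projection has the eigenvalue 1 exactly once, so [2 P - 1] has the eigenvalue -1
    with multiplicity [n - 1], which is even; the determinant is then 1. [M] collects the indices of
    the eigenvalue -1. *)
Lemma line_reflection (C : numClosedFieldType) n (P : 'M[C]_n) :
  P ^t* = P -> P *m P = P -> \tr P = 1 -> odd n ->
  [/\ P *+ 2 - 1%:M \is unitarymx, \det (P *+ 2 - 1%:M) = 1 &
    exists W (M : pred 'I_n), [/\ W \is unitarymx, #|M| = n.-1 &
      forall j, M j -> (W *m (P *+ 2 - 1%:M) *m W ^t*) j j = -1]].
Proof.
move=> Pa PP trP n_odd; have [W [D [Wu PE D01]]] := projection_mxfun Pa PP.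
pose f (z : C) := z *+ 2 - 1.
have YE : P *+ 2 - 1%:M = mxfun f W D.
  rewrite mulr2n PE -(mxfun1 D Wu) mxfunN !mxfunD.
  by apply: eq_mxfun => j; rewrite /f mulr2n.
have fE j : f (D 0 j) = if D 0 j == 1 then 1 else -1.
  have := D01 j; rewrite /f; case: eqP => [-> _|_ ->]; first by rewrite mulr2n addrK.
  by rewrite mul0rn add0r.
have card1 : #|[pred j | D 0 j == 1]| = 1%N.
  have : \tr P = #|[pred j | D 0 j == 1]|%:R.
    rewrite PE mxtrace_mxfun // -sum1_card natr_sum [RHS]big_mkcond /=.
    apply: eq_bigr => j _; rewrite inE.
    by have := D01 j; case: (D 0 j == 1) => ->.
  by rewrite trP => /esym/eqP; rewrite pnatr_eq1 => /eqP.
have cardN : #|[pred j | D 0 j != 1]| = n.-1.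
  have := cardC [pred j | D 0 j == 1].
  rewrite card1 card_ord add1n => /(congr1 predn) <- /=.
  by apply: eq_card => j; rewrite !inE.
rewrite YE; split.
- apply/unitarymxP; rewrite mxfun_adj mxfunM // -(mxfun1 D Wu).
  apply: eq_mxfun => j; rewrite fE.
  by case: eqP; rewrite ?rmorphN rmorph1 ?mulrNN mulr1.
- rewrite det_mxfun // (eq_bigr (fun j => if D 0 j != 1 then -1 else 1)).
    rewrite -big_mkcond prodr_const cardN -signr_odd.
    by case: (n) n_odd => //= k /negPf ->; rewrite expr0.
  by move=> j _; rewrite fE; case: (D 0 j == 1).
exists W, [pred j | D 0 j != 1]; split=> // j /= Dj.
rewrite /mxfun !mulmxA (unitarymxP Wu) mul1mx -mulmxA (unitarymxP Wu) mulmx1.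
by rewrite !mxE eqxx mulr1n fE (negPf Dj).
Qed.

(** * Geodesics *)

Section Cis.
Variable R : realType.
Implicit Types (x y : R) (z : R[i]).

Lemma conj_complex z : z^* = Complex (complex.Re z) (- complex.Im z).
Proof. by case: z. Qed.

Definition cis x : R[i] := Complex (cos x) (sin x).

Lemma cis0 : cis 0 = 1. Proof. by rewrite /cis cos0 sin0. Qed.

Lemma cispi : cis pi = -1.
Proof. by rewrite /cis cospi sinpi; apply/eqP; rewrite eq_complex /= oppr0 !eqxx. Qed.

Lemma cisN x : cis (- x) = (cis x)^*.
Proof. by rewrite /cis cosN sinN. Qed.

Lemma cisD x y : cis (x + y) = cis x * cis y.
Proof.
rewrite /cis cosD sinD; apply/eqP; rewrite eq_complex /= eqxx /=.
by apply/eqP; ring.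
Qed.

(** Principal argument, in []-pi, pi]], of a complex number of modulus 1. Conjugation changes its
    sign except at -1, where it is [pi]. *)
Definition carg z : R :=
  if 0 <= complex.Im z then acos (complex.Re z) else - acos (complex.Re z).

Lemma unit_complexP z : (z * z^* == 1) = (complex.Re z ^+ 2 + complex.Im z ^+ 2 == 1).
Proof.
case: z => a b; rewrite conj_complex eq_complex /=.
rewrite !mulrN opprK [b * a]mulrC addNr eqxx andbT -!expr2 //.
Qed.

Lemma unit_complex_Re z : z * z^* = 1 -> -1 <= complex.Re z <= 1.
Proof.
move=> /eqP; rewrite unit_complexP => /eqP h.
by rewrite -ler_norml -[1]sqrtr1 -sqrtr_sqr ler_wsqrtr // -h lerDl sqr_ge0.
Qed.

Lemma cis_carg z : z * z^* = 1 -> cis (carg z) = z.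
Proof.
move=> zz; have zRe := unit_complex_Re zz.
move/eqP: zz; rewrite unit_complexP => /eqP h.
have s : sin (acos (complex.Re z)) = `|complex.Im z|.
  by rewrite sin_acos // -h addrC addKr sqrtr_sqr.
have c : cos (acos (complex.Re z)) = complex.Re z by apply: acosK; rewrite in_itv.
rewrite /carg; case: ifPn => [Im0|]; rewrite /cis ?cosN ?sinN c s.
  by rewrite ger0_norm //; case: (z).
by rewrite -ltNge => Im0; rewrite ltr0_norm // opprK; case: (z).
Qed.

Lemma norm_carg z : z * z^* = 1 -> `|carg z| <= pi.
Proof.
move=> /unit_complex_Re zz; rewrite /carg; case: ifP => _; rewrite ?normrN.
  by rewrite ger0_norm ?acos_ge0 ?acos_lepi.
by rewrite ger0_norm ?acos_ge0 ?acos_lepi.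
Qed.

Lemma carg1 : carg 1 = 0. Proof. by rewrite /carg /= lexx acos1. Qed.

Lemma cargN1 : carg (-1) = pi.
Proof. by rewrite /carg /= oppr0 lexx acosN1. Qed.

Lemma carg_conj z : z * z^* = 1 -> z != -1 -> carg z^* = - carg z.
Proof.
move=> /eqP; rewrite unit_complexP conj_complex /carg /=.
case: z => a b /=; rewrite eq_complex /= oppr0 oppr_ge0.
case: (ltgtP b 0) => [b0 _ _|b0 _ _|->]; rewrite ?opprK //.
rewrite expr0n addr0 andbT sqrf_eq1 => /orP[]/eqP ->; last by rewrite eqxx.
by rewrite acos1 oppr0.
Qed.

End Cis.

(** * Differentiation of complex matrix curves *)

Section Velocity.
Variable R : realType.
Local Notation Re := (@complex.Re R).
Local Notation Im := (@complex.Im R).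

(** Bundling the derivative with its continuity lets one calculus yield both [C1_curve] and the
    value of [velocity]. *)
Definition has_cderiv (g g' : R -> R[i]) : Prop :=
  [/\ forall t : R, is_derive t (1 : R) (fun s => Re (g s)) (Re (g' t)),
      forall t : R, is_derive t (1 : R) (fun s => Im (g s)) (Im (g' t)),
      continuous (fun t => Re (g' t)) & continuous (fun t => Im (g' t))].

Lemma has_cderiv_cst (a : R[i]) : has_cderiv (fun=> a) (fun=> 0).
Proof.
by split; [move=> t; exact: is_derive_cst|move=> t; exact: is_derive_cst| |];
  move=> t; exact: cvg_cst.
Qed.

Lemma has_cderivD f f' g g' : has_cderiv f f' -> has_cderiv g g' ->
  has_cderiv (fun t => f t + g t) (fun t => f' t + g' t).
Proof.
move=> [f1 f2 f3 f4] [g1 g2 g3 g4].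
have ReD (x y : R[i]) : Re (x + y) = Re x + Re y by case: x y => ? ? [].
have ImD (x y : R[i]) : Im (x + y) = Im x + Im y by case: x y => ? ? [].
split.
- by move=> t; under eq_fun do rewrite ReD; rewrite ReD; exact: is_deriveD.
- by move=> t; under eq_fun do rewrite ImD; rewrite ImD; exact: is_deriveD.
- by under eq_fun do rewrite ReD; move=> t; apply: cvgD; [exact: f3|exact: g3].
- by under eq_fun do rewrite ImD; move=> t; apply: cvgD; [exact: f4|exact: g4].
Qed.

Lemma has_cderivZ a f f' : has_cderiv f f' ->
  has_cderiv (fun t => a * f t) (fun t => a * f' t).
Proof.
move=> [f1 f2 f3 f4].
have ReM (b x : R[i]) : Re (b * x) = Re b *: Re x - Im b *: Im x.
  by case: b x => ? ? [].
have ImM (b x : R[i]) : Im (b * x) = Re b *: Im x + Im b *: Re x.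
  by case: b x => ? ? [].
split.
- by move=> t; under eq_fun do rewrite ReM; rewrite ReM; apply: is_deriveB.
- by move=> t; under eq_fun do rewrite ImM; rewrite ImM; apply: is_deriveD.
- under eq_fun do rewrite ReM; move=> t.
  by apply: cvgB; apply: cvgZr; [exact: f3|exact: f4].
- under eq_fun do rewrite ImM; move=> t.
  by apply: cvgD; apply: cvgZr; [exact: f4|exact: f3].
Qed.

Lemma has_cderiv_sum n (f f' : 'I_n -> R -> R[i]) :
  (forall i, has_cderiv (f i) (f' i)) ->
  has_cderiv (fun t => \sum_i f i t) (fun t => \sum_i f' i t).
Proof.
elim: n f f' => [|n IH] f f' h.
  under eq_fun do rewrite big_ord0.
  under [X in has_cderiv _ X]eq_fun do rewrite big_ord0.
  exact: has_cderiv_cst.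
under eq_fun do rewrite big_ord_recr /=.
under [X in has_cderiv _ X]eq_fun do rewrite big_ord_recr /=.
by apply: has_cderivD => //; apply: IH.
Qed.

Lemma has_cderiv_cis (a : R) :
  has_cderiv (fun t => cis (t * a)) (fun t => Complex 0 a * cis (t * a)).
Proof.
have d (t : R) : is_derive t 1 (fun s : R => s * a) a.
  apply: is_derive_eq; by rewrite scaler0 add0r /GRing.scale /= mulr1.
have ct : continuous (fun t : R => t * a).
  by move=> t; apply: cvgM; [exact: cvg_id|exact: cvg_cst].
split.
- move=> t; apply: is_derive_eq.
    exact: (is_derive1_comp (f := cos) (g := fun s : R => s * a)).
  by rewrite /= mul0r sub0r mulrC mulrN.
- move=> t; apply: is_derive_eq.
    exact: (is_derive1_comp (f := sin) (g := fun s : R => s * a)).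
  by rewrite /= mul0r add0r mulrC.
- move=> t /=; apply: cvgB; apply: cvgM; try exact: cvg_cst.
    by apply: (cvg_comp _ _ (ct t)); exact: continuous_cos.
  by apply: (cvg_comp _ _ (ct t)); exact: continuous_sin.
- move=> t /=; apply: cvgD; apply: cvgM; try exact: cvg_cst.
    by apply: (cvg_comp _ _ (ct t)); exact: continuous_sin.
  by apply: (cvg_comp _ _ (ct t)); exact: continuous_cos.
Qed.

Definition has_velocity n (c v : R -> 'M[R[i]]_n) : Prop :=
  forall i j, has_cderiv (fun t => c t i j) (fun t => v t i j).

Lemma has_velocityD n (c v d w : R -> 'M[R[i]]_n) :
  has_velocity c v -> has_velocity d w ->
  has_velocity (fun t => c t + d t) (fun t => v t + w t).
Proof.
move=> h k i j; under eq_fun do rewrite mxE.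
under [X in has_cderiv _ X]eq_fun do rewrite mxE.
exact: has_cderivD.
Qed.

Lemma has_velocityMl n (X : 'M[R[i]]_n) (c v : R -> 'M[R[i]]_n) :
  has_velocity c v -> has_velocity (fun t => X *m c t) (fun t => X *m v t).
Proof.
move=> h i j; under eq_fun do rewrite mxE.
under [X in has_cderiv _ X]eq_fun do rewrite mxE.
by apply: has_cderiv_sum => k; exact: has_cderivZ.
Qed.

Lemma has_velocityMr n (X : 'M[R[i]]_n) (c v : R -> 'M[R[i]]_n) :
  has_velocity c v -> has_velocity (fun t => c t *m X) (fun t => v t *m X).
Proof.
move=> h i j; under eq_fun do (rewrite mxE; under eq_bigr do rewrite mulrC).
under [X in has_cderiv _ X]eq_fun do
  (rewrite mxE; under eq_bigr do rewrite mulrC).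
by apply: has_cderiv_sum => k; exact: has_cderivZ.
Qed.

Lemma has_velocity_C1 n (c v : R -> 'M[R[i]]_n) :
  has_velocity c v -> C1_curve c /\ velocity c = v.
Proof.
move=> h; split.
  move=> i j; have [h1 h2 h3 h4] := h i j.
  split; split.
  - by move=> t; exact: (@ex_derive _ _ _ _ _ _ _ (h1 t)).
  - rewrite (_ : derive1 _ = fun t => Re (v t i j)) //; apply/funext => t.
    by rewrite derive1E; exact: (@derive_val _ _ _ _ _ _ _ (h1 t)).
  - by move=> t; exact: (@ex_derive _ _ _ _ _ _ _ (h2 t)).
  - rewrite (_ : derive1 _ = fun t => Im (v t i j)) //; apply/funext => t.
    by rewrite derive1E; exact: (@derive_val _ _ _ _ _ _ _ (h2 t)).
apply/funext => t; apply/matrixP => i j; rewrite mxE.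
have [h1 h2 _ _] := h i j.
rewrite /re_entry /im_entry !derive1E.
rewrite (@derive_val _ _ _ _ _ _ _ (h1 t)) (@derive_val _ _ _ _ _ _ _ (h2 t)).
by case: (v t i j).
Qed.

Lemma C1_has_velocity n (c : R -> 'M[R[i]]_n) :
  C1_curve c -> has_velocity c (velocity c).
Proof.
move=> h i j; have [[h1 h2] [h3 h4]] := h i j; split.
- move=> t; rewrite mxE /= derive1E; exact: derivableP.
- move=> t; rewrite mxE /= derive1E; exact: derivableP.
- by under eq_fun do rewrite mxE.
- by under eq_fun do rewrite mxE.
Qed.

End Velocity.

Section Geodesic.
Variables (R : realType) (n : nat).
Variables (W : 'M[R[i]]_n) (D : 'rV[R[i]]_n) (Pp Pm : 'M[R[i]]_n).
Hypothesis Wu : W \is unitarymx.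
Hypothesis D1 : forall j, D 0 j * (D 0 j)^* = 1.
Hypothesis split_P : splits_proj (proj_opp1 W D) Pp Pm.

(** The one-parameter group [exp (t L)] of a logarithm [L] of [mxfun id W D]: [L] is [i carg z] on
    the eigenspace of [z] other than -1, [i pi] on the range of [Pp], and [- i pi] on that of
    [Pm]. *)
Definition geodesic (t : R) : 'M[R[i]]_n :=
  splitfun W D Pp Pm (fun z => cis (t * carg z)) (cis (t * pi)) (cis (t * - pi)).

Definition geodesic_velocity (t : R) : 'M[R[i]]_n :=
  splitfun W D Pp Pm (fun z => Complex 0 (carg z) * cis (t * carg z))
    (Complex 0 pi * cis (t * pi)) (Complex 0 (- pi) * cis (t * - pi)).

Lemma geodesicD s t : geodesic (s + t) = geodesic s *m geodesic t.
Proof.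
rewrite /geodesic (splitfunM Wu split_P) -!cisD -!(mulrDl s t).
by apply: eq_splitfun => j _; rewrite -cisD -(mulrDl s t).
Qed.

Lemma geodesic0 : geodesic 0 = 1%:M.
Proof.
rewrite /geodesic !mul0r cis0 -(splitfun1 Wu split_P).
by apply: eq_splitfun => j _; rewrite mul0r cis0.
Qed.

Lemma geodesic1 : geodesic 1 = mxfun id W D.
Proof.
rewrite /geodesic !mul1r cisN cispi rmorphN rmorph1 -(splitfun_id split_P).
by apply: eq_splitfun => j _; rewrite mul1r cis_carg.
Qed.

Lemma geodesic_adj t : (geodesic t) ^t* = geodesic (- t).
Proof.
rewrite /geodesic (splitfun_adj split_P) -!cisN -!mulNr.
by apply: eq_splitfun => j _; rewrite -cisN mulNr.
Qed.

Lemma geodesic_unitary t : geodesic t \is unitarymx.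
Proof. by apply/unitarymxP; rewrite geodesic_adj -geodesicD subrr geodesic0. Qed.

Lemma geodesic_half t : geodesic t = geodesic (t / 2) *m geodesic (t / 2).
Proof. by rewrite -geodesicD -splitr. Qed.

Lemma geodesic_has_velocity : has_velocity geodesic geodesic_velocity.
Proof.
have Z (a a' : R -> R[i]) (A : 'M[R[i]]_n) : has_cderiv a a' ->
    has_velocity (fun t => a t *: A) (fun t => a' t *: A).
  move=> h i j; under eq_fun do rewrite mxE mulrC.
  by under [X in has_cderiv _ X]eq_fun do rewrite mxE mulrC; exact: has_cderivZ.
apply: has_velocityD; [apply: has_velocityD|]; try exact: Z (has_cderiv_cis _).
apply: has_velocityMr; apply: has_velocityMl => i j.
under eq_fun do rewrite !mxE; under [X in has_cderiv _ X]eq_fun do rewrite !mxE.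
have [->|] := eqVneq i j; last first.
  by move=> _; exact: has_cderiv_cst.
case: eqP => _; first exact: has_cderiv_cst.
exact: has_cderiv_cis.
Qed.

(** The numbers [pi] and [- pi] have the same square, so the trace does not see how the eigenspace
    of -1 is split. *)
Lemma geodesic_speed t :
  frobenius (geodesic_velocity t) (geodesic_velocity t)
  = \sum_j carg (D 0 j) ^+ 2.
Proof.
have key (a b : R) : Complex 0 a * cis b * (Complex 0 a * cis b)^* = (a ^+ 2)%:C%C.
  apply/eqP; rewrite conj_complex /cis eq_complex /= -[a ^+ 2]mulr1.
  by rewrite -(cos2Dsin2 b); apply/andP; split; apply/eqP; ring.
rewrite /frobenius (splitfun_adj split_P) splitfunM // !key sqrrN.
rewrite (@eq_splitfun _ _ _ _ _ _ _ (fun z => (carg z ^+ 2)%:C%C)) => [|j _];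
  last first.
  exact: key.
rewrite mxtrace_splitfun // (eq_bigr (fun j => (carg (D 0 j) ^+ 2)%:C%C)).
  by rewrite -rmorph_sum.
by move=> j _; case: eqP => // ->; rewrite cargN1.
Qed.

End Geodesic.

(** * Upper bounds for distances *)

Section UpperBound.
Variables (R : realType) (n : nat).

Lemma frobenius_unitaryMl (X V : 'M[R[i]]_n) : X \is unitarymx ->
  frobenius (X *m V) (X *m V) = frobenius V V.
Proof.
move=> Xu; rewrite /frobenius adjM !mulmxA mxtrace_mulC !mulmxA.
by rewrite unitary_adjK // mul1mx.
Qed.

Lemma frobenius_unitaryMr (X V : 'M[R[i]]_n) : X \is unitarymx ->
  frobenius (V *m X) (V *m X) = frobenius V V.
Proof. by move=> Xu; rewrite /frobenius adjM mulmxA mulmxtVK. Qed.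

Lemma dist_constant_speed (G : set 'M[R[i]]_n) (c v : R -> 'M[R[i]]_n) (a : R) :
  has_velocity c v -> (forall t, G (c t)) -> (forall t, frobenius (v t) (v t) = a) ->
  (riemannian_dist G (@frobenius R n) (c 0%R) (c 1%R) <= (Num.sqrt a)%:E)%E.
Proof.
move=> /has_velocity_C1 [cC1 cv] Gc va; apply: ereal_inf_lbound => /=.
exists c.
  split=> //; exists [:: 1]; split=> //=; first by rewrite ltr01.
  by case=> // _; exists c.
rewrite /curve_length cv; under eq_integral do rewrite va.
by rewrite integral_cst //= lebesgue_measure_itv /= lte_fin ltr01 sube0 mule1.
Qed.

Lemma dist_geodesic (G : set 'M[R[i]]_n) (X W : 'M[R[i]]_n) (D : 'rV[R[i]]_n)
    (Pp Pm : 'M[R[i]]_n) :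
  X \is unitarymx -> W \is unitarymx -> (forall j, D 0 j * (D 0 j)^* = 1) ->
  splits_proj (proj_opp1 W D) Pp Pm ->
  (forall t, G (X *m geodesic W D Pp Pm t)) ->
  (riemannian_dist G (@frobenius R n) X (X *m mxfun id W D)
   <= (Num.sqrt (\sum_j carg (D 0 j) ^+ 2))%:E)%E.
Proof.
move=> Xu Wu D1 split_P GX.
have := dist_constant_speed (has_velocityMl X (geodesic_has_velocity W D Pp Pm)) GX.
rewrite (geodesic0 Wu split_P) mulmx1 (geodesic1 D1 split_P); apply => t.
by rewrite frobenius_unitaryMl // geodesic_speed.
Qed.

(** An eigenvalue 1 contributes nothing to the sum, and every other one contributes at most
    [pi ^+ 2]. *)
Lemma sum_carg_sqr_le (D : 'rV[R[i]]_n) k :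
  (forall j, D 0 j * (D 0 j)^* = 1) -> (#|[pred j | (D 0 j != 1)%R]| <= k)%N ->
  Num.sqrt (\sum_j carg (D 0 j) ^+ 2) <= Num.sqrt k%:R * pi.
Proof.
move=> D1 Dk; rewrite -[pi in leRHS]ger0_norm ?pi_ge0 // -sqrtr_sqr -sqrtrM //.
apply: ler_wsqrtr; apply: (@le_trans _ _ (\sum_(j | D 0 j != 1) pi ^+ 2)).
  rewrite [leRHS]big_mkcond /=; apply: ler_sum => j _; case: eqP => [->|_].
    by rewrite carg1 expr0n.
  by rewrite -real_normK ?num_real // lerXn2r ?nnegrE ?pi_ge0 ?norm_carg.
rewrite sumr_const -[leLHS]mulr_natl ler_wpM2r ?sqr_ge0 // ler_nat.
exact: Dk.
Qed.

End UpperBound.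

Section Commutant.
Variables (R : realType) (n : nat) (V : 'M[R[i]]_n).

Lemma commutant_dist_le X Y : commutant_U V X -> commutant_U V Y ->
  (riemannian_dist (commutant_U V) (@frobenius R n) X Y
   <= (Num.sqrt n%:R * pi)%:E)%E.
Proof.
move=> [Xu XV] [Yu YV].
have [Zu YE] := unitary_quotient Xu Yu.
have ZV := commutant_quotient Xu XV YV.
have [W [D [Wu ZE D1]]] := unitary_mxfun Zu.
have split_P := splits_proj_opp1_0 D Wu.
rewrite -YE ZE; rewrite ZE in ZV.
apply: le_trans (dist_geodesic Xu Wu D1 split_P _) _ => [t|].
  have gu := geodesic_unitary Wu split_P t.
  split; first exact: (mul_unitarymx Xu gu).
  apply: (commutant_mul XV).
  exact: (splitfun_comm Wu split_P _ _ _ erefl ZV).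
by rewrite lee_fin sum_carg_sqr_le // -[leqRHS]card_ord max_card.
Qed.

End Commutant.

Section TwistedCommutant.
Variables (R : realType) (n : nat) (Q : 'M[R]_n).
Hypothesis QO : O_ Q.

Lemma complexified_orthogonal : map_mx (real_complex R) Q \is unitarymx /\
  cmx (map_mx (real_complex R) Q) = map_mx (real_complex R) Q.
Proof.
have Qreal : cmx (map_mx (real_complex R) Q) = map_mx (real_complex R) Q.
  by apply/matrixP => i j; rewrite !mxE conj_complex /= oppr0.
split=> //; apply/unitarymxP.
have -> : (map_mx (real_complex R) Q) ^t* = map_mx (real_complex R) Q^T.
  by apply/matrixP => i j; rewrite !mxE conj_complex /= oppr0.
by rewrite -map_mxM QO map_mx1.
Qed.

Lemma twisted_dist_le k X Y :
  (odd n -> (k = n.-1)%N) -> (~~ odd n -> k = n) ->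
  twisted_commutant_SU Q X -> twisted_commutant_SU Q Y ->
  (riemannian_dist (twisted_commutant_SU Q) (@frobenius R n) X Y
   <= (Num.sqrt k%:R * pi)%:E)%E.
Proof.
move=> k_odd k_even [[Xu dX] XQ] [[Yu dY] YQ].
set Qc := map_mx _ Q in XQ YQ.
have [Qu Qreal] := complexified_orthogonal.
have [Zu YE] := unitary_quotient Xu Yu.
have ZQ := twisted_quotient Xu XQ YQ.
have dZ := det_unitary_quotient dX dY.
have [W [D [Wu ZE D1]]] := unitary_mxfun Zu.
rewrite -YE ZE; rewrite ZE in ZQ Zu dZ.
have [Pp [Pm [split_P PpQ]]] := twisted_splits Qu Qreal Wu dZ D1 ZQ.
have gQ t : geodesic W D Pp Pm t *m Qc = Qc *m cmx (geodesic W D Pp Pm t).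
  rewrite /geodesic mulrN cisN.
  apply: (splitfun_twisted Wu split_P _ ZQ PpQ) => j Dj; rewrite -cisN -mulrN.
  by rewrite carg_conj.
apply: le_trans (dist_geodesic Xu Wu D1 split_P _) _ => [t|].
  have gu := geodesic_unitary Wu split_P.
  split; last exact: (twisted_mul XQ (gQ t)).
  split; first exact: (mul_unitarymx Xu (gu t)).
  (* The determinant of the geodesic at [t] is the square of the one at [t / 2], which is 1 or -1
     because that point also satisfies the twisted relation. *)
  rewrite det_mulmx dX mul1r (geodesic_half Wu split_P) det_mulmx -expr2.
  exact: (unitary_twisted_det_sqr Qu (gu _) (gQ _)).
rewrite lee_fin sum_carg_sqr_le //; case: (boolP (odd n)) => n_odd; last first.
  by rewrite k_even // -[leqRHS]card_ord max_card.
(* The index [j] of the eigenvalue 1 is missing from the count, which gives [n.-1]. *)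
rewrite k_odd //; have [j Dj] := twisted_eigenvalue1 Qu Wu Zu dZ ZQ n_odd.
rewrite -[n in leqRHS]card_ord -(cardC1 j); apply: subset_leq_card.
by apply/fintype.subsetP => i; rewrite !inE; apply: contraNneq => ->; rewrite Dj.
Qed.

End TwistedCommutant.

(** * Lower bound on lengths *)

Section CauchySchwarz.
Variables (R : realFieldType) (I : finType).
Implicit Types (x y : I -> R).

Lemma cauchy_schwarz_sum x y :
  (\sum_i x i * y i) ^+ 2 <= (\sum_i x i ^+ 2) * (\sum_i y i ^+ 2).
Proof.
set s := \sum_i x i * y i; set q := \sum_i y i ^+ 2; set p := \sum_i x i ^+ 2.
have q0 : 0 <= q by apply: sumr_ge0 => i _; exact: sqr_ge0.
(* This is the squared norm of [q x - s y], that is, of [q] times the component of [x] orthogonal to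
   [y]. *)
have key : 0 <= q * (p * q - s ^+ 2).
  have -> : q * (p * q - s ^+ 2) = \sum_i (q * x i - s * y i) ^+ 2.
    transitivity (\sum_i (q ^+ 2 * x i ^+ 2 + s ^+ 2 * y i ^+ 2
                          - 2 * q * s * (x i * y i))).
      rewrite sumrB big_split /= -!mulr_sumr -/p -/q -/s; ring.
    by apply: eq_bigr => i _; ring.
  by apply: sumr_ge0 => i _; exact: sqr_ge0.
have [qE|qN0] := eqVneq q 0; last first.
  by rewrite -subr_ge0 -(pmulr_rge0 _ (_ : 0 < q)) // lt_def qN0.
suff -> : s = 0 by rewrite expr0n /= qE mulr0.
apply: big1 => i _; move/eqP: qE; rewrite psumr_eq0 => [/allP /(_ i)|k _].
  by rewrite mem_index_enum sqrf_eq0 => /(_ isT) /eqP ->; rewrite mulr0.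
exact: sqr_ge0.
Qed.

(* The coordinate [i0] changes at rate at most |x'| sqrt (1 - x_i0^2), since
   the tangent vector [x'] is orthogonal to [x]. *)
Lemma sphere_tangent_bound x x' i0 :
  \sum_i x i ^+ 2 = 1 -> \sum_i x i * x' i = 0 ->
  x' i0 ^+ 2 <= (\sum_i x' i ^+ 2) * (1 - x i0 ^+ 2).
Proof.
(* [w] is the basis vector of index [i0] projected onto the hyperplane orthogonal to [x]; it has the
   same product with [x'] and squared norm [1 - x i0 ^+ 2]. *)
move=> xx xx'; pose w i := (i == i0)%:R - x i0 * x i.
have sel (z : I -> R) : \sum_i (i == i0)%:R * z i = z i0.
  rewrite (bigD1 i0) //= eqxx mul1r big1 ?addr0 // => i /negPf ->.
  by rewrite mul0r.
have -> : x' i0 = \sum_i x' i * w i.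
  transitivity (\sum_i (i == i0)%:R * x' i - x i0 * \sum_i x i * x' i).
    by rewrite sel xx' mulr0 subr0.
  by rewrite mulr_sumr -sumrB; apply: eq_bigr => i _; rewrite /w; ring.
have -> : 1 - x i0 ^+ 2 = \sum_i w i ^+ 2; last exact: cauchy_schwarz_sum.
transitivity (\sum_i ((i == i0)%:R * (1 - 2 * x i0 * x i) + x i0 ^+ 2 * x i ^+ 2)).
  by rewrite big_split /= sel -mulr_sumr xx; ring.
by apply: eq_bigr => i _; rewrite /w; case: (i == i0) => /=; ring.
Qed.

End CauchySchwarz.

Section RealLemmas.
Variable R : realType.

(** The fundamental theorem of calculus combined with monotonicity of the integral. The bound on [f]
    is asked only inside the interval, where a row of a unitary curve is known to be orthogonal to
    its derivative; the endpoints are negligible. *)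
Lemma increment_le_integral (F f g : R -> R) (k a b : R) : a < b -> 0 <= k ->
  (forall t, a <= t <= b -> is_derive t (1 : R) F (f t)) ->
  (forall t, a <= t <= b -> {for t, continuous f}) ->
  continuous g -> (forall t, 0 <= g t) ->
  (forall t, a < t < b -> f t <= k * g t) ->
  ((F b - F a)%:E <= k%:E * \int[lebesgue_measure]_(t in `[a, b]) (g t)%:E)%E.
Proof.
move=> ab k0 dF cf cg g0 fg.
have wf : {within `[a, b], continuous f}.
  by apply: continuous_in_subspaceT => t; rewrite inE /= in_itv /= => /cf.
have wg : {within `[a, b], continuous (fun t => k * g t)}.
  by apply: continuous_subspaceT => t; apply: cvgM; [exact: cvg_cst|exact: cg].
have If := continuous_compact_integrable (@segment_compact _ a b) wf.
have Ig := continuous_compact_integrable (@segment_compact _ a b) wg.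
have F_cts t : a <= t <= b -> {for t, continuous F}.
  move=> /dF dFt; apply: differentiable_continuous; apply/derivable1_diffP.
  exact: (@ex_derive _ _ _ _ _ _ _ dFt).
have <- : (\int[lebesgue_measure]_(t in `[a, b]) (f t)%:E)%E = (F b - F a)%:E.
  rewrite (@continuous_FTC2 _ f F a b) //.
    split.
    - move=> t; rewrite in_itv /= => /andP[a_t t_b].
      by apply: (@ex_derive _ _ _ _ _ _ _ (dF t _)); rewrite !ltW.
    - by apply: cvg_at_right_filter; apply: F_cts; rewrite lexx ltW.
    - by apply: cvg_at_left_filter; apply: F_cts; rewrite lexx ltW.
  move=> t; rewrite in_itv /= => /andP[a_t t_b]; rewrite derive1E.
  by apply: (@derive_val _ _ _ _ _ _ _ (dF t _)); rewrite !ltW.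
have mg : measurable_fun [set: R] (EFin \o g).
  by apply/measurable_EFinP; exact: continuous_measurable_fun.
rewrite -ge0_integralZl //; last 2 first.
- exact: measurable_funTS mg.
- by move=> t _; rewrite lee_fin.
have m_oo (h : R -> R) : lebesgue_measure.-integrable `[a, b] (EFin \o h) ->
    lebesgue_measure.-integrable `]a, b[ (EFin \o h).
  by apply: integrableS => //; exact: subset_itv_oo_cc.
rewrite (@integral_itv_bndoo _ a b (fun t => (f t)%:E)); last first.
  by have /integrableP[] := m_oo _ If.
rewrite (@integral_itv_bndoo _ a b (fun t => k%:E * (g t)%:E)%E); last first.
  by have /integrableP[] := m_oo _ Ig.
apply: le_integral; [by []|exact: (m_oo _ If)|exact: (m_oo _ Ig)|].
by move=> t; rewrite inE /= in_itv /= => /fg; rewrite -EFinM lee_fin.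
Qed.

End RealLemmas.

Section SumDerive.
Variables (R : realType) (I : Type).

Lemma is_derive_bigsum (r : seq I) (P : pred I) (h : I -> R -> R) (dh : I -> R)
    (t : R) : (forall i, P i -> is_derive t (1 : R) (h i) (dh i)) ->
  is_derive t (1 : R) (fun s => \sum_(i <- r | P i) h i s)
    (\sum_(i <- r | P i) dh i).
Proof.
move=> hd; elim: r => [|i r IH].
  under eq_fun do rewrite big_nil; rewrite big_nil.
  exact: is_derive_cst.
under eq_fun do rewrite big_cons; rewrite big_cons.
by case: ifPn => // /hd ?; exact: is_deriveD.
Qed.

Lemma cvg_bigsum (r : seq I) (P : pred I) (h : I -> R -> R) (t : R) :
  (forall i, P i -> h i x @[x --> t] --> h i t) ->
  (\sum_(i <- r | P i) h i x) @[x --> t] --> \sum_(i <- r | P i) h i t.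
Proof.
move=> hc; elim: r => [|i r IH].
  by under eq_fun do rewrite big_nil; rewrite big_nil; exact: cvg_cst.
under eq_fun do rewrite big_cons; rewrite big_cons.
by case: ifPn => // /hc ?; exact: cvgD.
Qed.

End SumDerive.

(** * Rows of unitary curves and their angles *)

Section Arcs.
Variables (R : realType) (n : nat).
Local Notation Re := (@complex.Re R).
Local Notation Im := (@complex.Im R).

Lemma Re_sum (F : 'I_n -> R[i]) : Re (\sum_k F k) = \sum_k Re (F k).
Proof. by elim/big_ind2 : _ => // x1 x2 y1 y2 <- <-; case: x2 y2 => ? ? []. Qed.

(** A row is seen as a point of real space of dimension [2 n], on the unit sphere if the matrix is
    unitary, so that [sphere_tangent_bound] applies. *)
Definition row_coords (A : 'M[R[i]]_n) (j : 'I_n) (s : 'I_n + 'I_n) : R :=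
  match s with inl k => Re (A j k) | inr k => Im (A j k) end.

Lemma mulmx_adj_row (A : 'M[R[i]]_n) j :
  Re ((A *m A ^t*) j j) = \sum_s row_coords A j s ^+ 2.
Proof.
rewrite big_sumType /= -big_split mxE Re_sum; apply: eq_bigr => k _ /=.
rewrite !mxE conj_complex; case: (A j k) => x y /=; ring.
Qed.

Lemma frobenius_rows (A : 'M[R[i]]_n) :
  frobenius A A = \sum_j \sum_s row_coords A j s ^+ 2.
Proof.
by rewrite /frobenius Re_sum; apply: eq_bigr => j _; exact: mulmx_adj_row.
Qed.

Lemma unitary_row (A : 'M[R[i]]_n) j :
  A \is unitarymx -> \sum_s row_coords A j s ^+ 2 = 1.
Proof. by move=> Au; rewrite -mulmx_adj_row (unitarymxP Au) mxE eqxx. Qed.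

Lemma unitary_diag_le1 (A : 'M[R[i]]_n) j :
  A \is unitarymx -> Re (A j j) ^+ 2 <= 1.
Proof.
move=> /(unitary_row j) <-; rewrite (bigD1 (inl j)) //= lerDl.
by apply: sumr_ge0 => s _; exact: sqr_ge0.
Qed.

Lemma is_derive_row (c v : R -> 'M[R[i]]_n) j s t : has_velocity c v ->
  is_derive t (1 : R) (fun u => row_coords (c u) j s) (row_coords (v t) j s).
Proof. by move=> h; case: s => k; have [h1 h2 _ _] := h j k. Qed.

Lemma continuous_row (c v : R -> 'M[R[i]]_n) j s : has_velocity c v ->
  continuous (fun u => row_coords (v u) j s).
Proof. by move=> h; case: s => k; have [_ _ h3 h4] := h j k. Qed.

Lemma continuous_row_curve (c v : R -> 'M[R[i]]_n) j s : has_velocity c v ->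
  continuous (fun u => row_coords (c u) j s).
Proof.
move=> h t; apply: differentiable_continuous; apply/derivable1_diffP.
exact: (@ex_derive _ _ _ _ _ _ _ (is_derive_row j s t h)).
Qed.

(** The squared norm of the row is constant near [t], so its derivative vanishes; for this [t] has
    to be interior. *)
Lemma unitary_row_orthogonal (c v : R -> 'M[R[i]]_n) j (a b t : R) :
  has_velocity c v -> (forall u, a <= u <= b -> c u \is unitarymx) ->
  a < t < b -> \sum_s row_coords (c t) j s * row_coords (v t) j s = 0.
Proof.
move=> h cu abt.
pose q (u : R) := \sum_s row_coords (c u) j s * row_coords (c u) j s.
have dq : is_derive t (1 : R) q
    (\sum_s (row_coords (c t) j s *: row_coords (v t) j s
             + row_coords (c t) j s *: row_coords (v t) j s)).
  apply: is_derive_bigsum => s _.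
  by have ds := is_derive_row j s t h; exact: is_deriveM.
have q1 : 'D_1 q t = 0.
  rewrite -(derive_cst (1 : R) t (1 : R)); apply: near_eq_derive.
  have /near_in_itvoo abI : t \in `]a, b[ by rewrite in_itv.
  near=> u; rewrite /q /=; under eq_bigr do rewrite -expr2.
  apply: unitary_row; apply: cu.
  have /itvP uI : u \in `]a, b[ by near: u.
  by rewrite !ltW ?uI.
move: q1; rewrite (@derive_val _ _ _ _ _ _ _ dq) big_split /= => /eqP.
by rewrite -mulr2n mulrn_eq0 /= => /eqP.
Unshelve. all: by end_near. Qed.

Definition speed (c : R -> 'M[R[i]]_n) (t : R) : R :=
  Num.sqrt (frobenius (velocity c t) (velocity c t)).

Lemma continuous_speed (c : R -> 'M[R[i]]_n) : C1_curve c -> continuous (speed c).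
Proof.
move=> /C1_has_velocity h t; rewrite /speed; under eq_fun do rewrite frobenius_rows.
apply: continuous_comp; last exact: sqrt_continuous.
apply: cvg_bigsum => j _; apply: cvg_bigsum => s _.
by under eq_fun do rewrite expr2; apply: cvgM; exact: (continuous_row h).
Qed.

End Arcs.

Section ArcLength.
Variables (R : realType) (n : nat).
Variables (W : 'M[R[i]]_n) (M : pred 'I_n) (l : R).
Hypothesis Wu : W \is unitarymx.
Hypothesis l01 : 0 < l < 1.
Local Notation Re := (@complex.Re R).

Definition frame (A : 'M[R[i]]_n) : 'M[R[i]]_n := W *m A *m W ^t*.

(* The factor [l < 1] keeps [acos] differentiable where the diagonal entries reach
   [1] or [-1]. *)
Definition arcs (A : 'M[R[i]]_n) : R :=
  \sum_(j | M j) acos (l * Re (frame A j j)).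

Let Wau : W ^t* \is unitarymx.
Proof. by rewrite trmxC_unitary. Qed.

Lemma unitary_frame A : A \is unitarymx -> frame A \is unitarymx.
Proof. by move=> Au; exact: (mul_unitarymx (mul_unitarymx Wu Au) Wau). Qed.

Lemma frobenius_frame A : frobenius (frame A) (frame A) = frobenius A A.
Proof. by rewrite (frobenius_unitaryMr _ Wau) (frobenius_unitaryMl _ Wu). Qed.

Let in_acos (x : R) : x ^+ 2 <= 1 -> -1 < l * x < 1.
Proof.
move: l01 => /andP[l0 l1]; rewrite -ler_sqrt ?ltr01 // sqrtr_sqr sqrtr1 => x1.
rewrite -ltr_norml normrM gtr0_norm //; apply: le_lt_trans l1.
by rewrite ger_pMr.
Qed.

Let sqr_lt1 (x : R) : x ^+ 2 <= 1 -> 0 < 1 - (l * x) ^+ 2.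
Proof.
move=> /in_acos; rewrite -ltr_norml => lx.
by rewrite subr_gt0 -real_normK ?num_real // expr_lt1.
Qed.

(** The left side is the derivative of [arcs]. By [sphere_tangent_bound] and
    [l^2 (1 - x^2) <= 1 - (l x)^2], each summand is at most the norm of the corresponding row of
    [V]; Cauchy-Schwarz against the indicator of [M] then gives the factor [sqrt #|M|]. *)
Lemma arcs_rate_bound (A V : 'M[R[i]]_n) :
  A \is unitarymx ->
  (forall j, \sum_s row_coords A j s * row_coords V j s = 0) ->
  \sum_(j | M j) - (Num.sqrt (1 - (l * Re (A j j)) ^+ 2))^-1 * (l * Re (V j j))
  <= Num.sqrt #|M|%:R * Num.sqrt (frobenius V V).
Proof.
move=> Au AV; pose r j := \sum_s row_coords V j s ^+ 2.
have r0 j : 0 <= r j by apply: sumr_ge0 => s _; exact: sqr_ge0.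
apply: (@le_trans _ _ (\sum_(j | M j) Num.sqrt (r j))).
  apply: ler_sum => j _.
  have A1 := unitary_diag_le1 j Au; have D0 := sqr_lt1 A1.
  rewrite mulrC mulrN -mulNr ler_pdivrMr ?sqrtr_gt0 // -sqrtrM //.
  apply: le_trans (ler_norm _) _; rewrite normrN -sqrtr_sqr.
  apply: ler_wsqrtr; rewrite exprMn.
  have := sphere_tangent_bound (inl j) (unitary_row j Au) (AV j).
  rewrite -/(r j) /= => h; move: l01 => /andP[l0 l1].
  have l2 : l ^+ 2 <= 1 by rewrite expr_le1 // ltW.
  apply: (@le_trans _ _ (l ^+ 2 * (r j * (1 - Re (A j j) ^+ 2)))).
    by rewrite ler_wpM2l // sqr_ge0.
  rewrite mulrCA ler_wpM2l // mulrBr mulr1 exprMn lerD2r //.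
rewrite frobenius_rows -/(\sum_j r j) -sqrtrM ?ler0n //.
have S0 : 0 <= \sum_(j | M j) Num.sqrt (r j).
  by apply: sumr_ge0 => j _; exact: sqrtr_ge0.
rewrite -[leLHS]ger0_norm // -sqrtr_sqr; apply: ler_wsqrtr.
have := cauchy_schwarz_sum (fun j => (M j)%:R) (fun j => Num.sqrt (r j)).
have -> : \sum_j (M j)%:R * Num.sqrt (r j) = \sum_(j | M j) Num.sqrt (r j).
  rewrite [RHS]big_mkcond; apply: eq_bigr => j _.
  by case: (M j); rewrite ?mul1r ?mul0r.
have -> : \sum_j (M j)%:R ^+ 2 = #|M|%:R :> R.
  rewrite -sum1_card natr_sum [RHS]big_mkcond; apply: eq_bigr => j _.
  by rewrite -[j \in M]/(M j); case: (M j); rewrite ?expr1n ?expr0n.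
by under [X in _ <= _ * X]eq_bigr do rewrite sqr_sqrtr //.
Qed.

Lemma arcs_piece (d : R -> 'M[R[i]]_n) (a b : R) : a < b -> C1_curve d ->
  (forall t, a <= t <= b -> d t \is unitarymx) ->
  ((arcs (d b) - arcs (d a))%:E
   <= (Num.sqrt #|M|%:R)%:E * \int[lebesgue_measure]_(t in `[a, b]) (speed d t)%:E)%E.
Proof.
move=> ab dC1 du; pose v t := frame (velocity d t).
have dv : has_velocity (fun t => frame (d t)) v.
  exact: (has_velocityMr (W ^t*) (has_velocityMl W (C1_has_velocity dC1))).
have fu t : a <= t <= b -> frame (d t) \is unitarymx by move=> /du /unitary_frame.
pose x j t := Re (frame (d t) j j); pose x' j t := Re (v t j j).
pose dG t := \sum_(j | M j) - (Num.sqrt (1 - (l * x j t) ^+ 2))^-1 * (l * x' j t).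
have dx j t : is_derive t (1 : R) (x j) (x' j t).
  exact: (is_derive_row j (inl j) t dv).
have dlx j t : is_derive t (1 : R) (fun s => l * x j s) (l * x' j t).
  by apply: is_deriveZ.
have cx j t : x j s @[s --> t] --> x j t.
  exact: (continuous_row_curve (j := j) (s := inl j) dv).
have cx' j t : x' j s @[s --> t] --> x' j t.
  exact: (continuous_row (j := j) (s := inl j) dv).
have clx j (t : R) : (fun s : R => l * x j s) @ t --> l * x j t.
  exact: (cvgM (cvg_cst l) (cx j t)).
apply: (@increment_le_integral _ (fun t => arcs (d t)) dG (speed d)) => //.
- move=> t /fu tu; apply: is_derive_bigsum => j Mj.
  have B := in_acos (unitary_diag_le1 j tu).
  have da := is_derive1_acos B.
  exact: (is_derive1_comp (f := acos) (g := fun s => l * x j s)).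
- move=> t /fu tu; apply: cvg_bigsum => j Mj.
  have B := sqr_lt1 (unitary_diag_le1 j tu).
  have sq : (fun s : R => 1 - (l * x j s) ^+ 2) @ t --> 1 - (l * x j t) ^+ 2.
    exact: (cvgB (cvg_cst (1 : R)) (cvgM (clx j t) (clx j t))).
  have rt : (fun s : R => Num.sqrt (1 - (l * x j s) ^+ 2)) @ t -->
      Num.sqrt (1 - (l * x j t) ^+ 2).
    exact: (cvg_comp _ _ sq (@sqrt_continuous R _)).
  have rt0 : Num.sqrt (1 - (l * x j t) ^+ 2) != 0 by rewrite gt_eqF // sqrtr_gt0.
  exact: (cvgM (cvgN (cvgV rt0 rt)) (cvgM (cvg_cst l) (cx' j t))).
- exact: continuous_speed.
- by move=> t; exact: sqrtr_ge0.
- move=> t abt; rewrite /speed -frobenius_frame; apply: arcs_rate_bound.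
    by apply: fu; case/andP: abt => ? ?; rewrite !ltW.
  by move=> j; exact: (unitary_row_orthogonal j dv fu abt).
Qed.

End ArcLength.

(** * Gluing the pieces of a piecewise C^1 curve *)

Section Subdivision.
Variables (R : realType) (n : nat).
Implicit Types (c d : R -> 'M[R[i]]_n) (a b : R).

Lemma near_eq_speed c d (t : R) : {near t, c =1 d} -> speed c t = speed d t.
Proof.
move=> cd; rewrite /speed (_ : velocity c t = velocity d t) //.
apply/matrixP => i j; rewrite !mxE !derive1E.
by congr Complex; apply: near_eq_derive; apply: filterS cd => u;
  rewrite /re_entry /im_entry => ->.
Qed.

Lemma eq_integral_itv_cc (f g : R -> R) a b :
  measurable_fun `]a, b[ f -> {in `]a, b[, f =1 g} ->
  (\int[lebesgue_measure]_(t in `[a, b]) (f t)%:E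
  = \int[lebesgue_measure]_(t in `[a, b]) (g t)%:E)%E.
Proof.
move=> mf fg; have mg : measurable_fun `]a, b[ g.
  by apply: eq_measurable_fun mf => t; rewrite inE /= => /fg.
have closed_open (h : R -> R) : measurable_fun `]a, b[ h ->
  (\int[lebesgue_measure]_(t in `[a, b]) (h t)%:E
   = \int[lebesgue_measure]_(t in `]a, b[) (h t)%:E)%E.
  by move=> mh; apply: integral_itv_bndoo; exact/measurable_EFinP.
rewrite !closed_open //.
by apply: eq_integral => t; rewrite inE /= => /fg ->.
Qed.

Lemma ge0_integral_itv_cat (f : R -> R) a b e : a <= b -> b <= e ->
  (forall t, 0 <= f t) -> measurable_fun `[a, b] f -> measurable_fun `[b, e] f ->
  measurable_fun `[a, e] f /\
  (\int[lebesgue_measure]_(t in `[a, e]) (f t)%:E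
   = \int[lebesgue_measure]_(t in `[a, b]) (f t)%:E
     + \int[lebesgue_measure]_(t in `[b, e]) (f t)%:E)%E.
Proof.
move=> ab be f0 m1 m2.
have mL : measurable_fun `[a, b[ f.
  by apply: (measurable_funS _ _ m1) => //; exact: subset_itv_co_cc.
have split_itv : `[a, e]%classic = `[a, b[ `|` `[b, e].
  apply/seteqP; split => t /=; rewrite !in_itv /=.
    move=> /andP[-> ->]; rewrite andbT /=.
    by case: (ltP t b) => ?; [left|right].
  case=> /andP[h1 h2]; apply/andP; split=> //.
    by rewrite ltW // (lt_le_trans h2).
  exact: le_trans ab h1.
have mA : measurable_fun `[a, e] f by rewrite split_itv; apply/measurable_funU.
split=> //; rewrite split_itv ge0_integral_setU //; first last.
- rewrite disj_set2E; apply/eqP/seteqP; split => t //= [].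
  by rewrite !in_itv /= => /andP[_ tb] /andP[/(lt_le_trans tb)]; rewrite ltxx.
- by move=> t _; rewrite lee_fin.
- by rewrite -split_itv; exact/measurable_EFinP.
by rewrite integral_itv_bndo_bndc //; exact/measurable_EFinP.
Qed.

(** At [a] and [b] the derivative of [c] also depends on its values outside the piece, so the speeds
    are compared only inside; the endpoints have measure zero. *)
Lemma speed_piece c d a b : C1_curve d -> (forall t, a <= t <= b -> c t = d t) ->
  measurable_fun `[a, b] (speed c) /\
  (\int[lebesgue_measure]_(t in `[a, b]) (speed c t)%:E
  = \int[lebesgue_measure]_(t in `[a, b]) (speed d t)%:E)%E.
Proof.
move=> dC1 cd.
have sE : {in `]a, b[, speed c =1 speed d}.
  move=> t tab; apply: near_eq_speed.
  have /near_in_itvoo abI := tab.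
  near=> u; apply: cd.
  have /itvP uI : u \in `]a, b[ by near: u.
  by rewrite !ltW ?uI.
have md : measurable_fun `]a, b[ (speed d).
  by apply: measurable_funTS; apply: continuous_measurable_fun; exact: continuous_speed.
have mc : measurable_fun `]a, b[ (speed c).
  apply: eq_measurable_fun md => t; rewrite inE /= => tab; apply/esym; exact: sE.
split; first exact: measurable_fun_itv_cc mc.
exact: eq_integral_itv_cc mc sE.
Unshelve. all: by end_near. Qed.

Lemma path_lt_le_last b (s : seq R) : path <%R b s -> b <= last b s.
Proof.
elim: s b => //= x s IH b /andP[bx /IH]; exact: le_trans (ltW bx).
Qed.

(** Induction on the subdivision, with a free starting point [a]. Measurability of the speed is
    carried along because adding the integrals of two pieces requires it. *)
Lemma arcs_subdivision W (M : pred 'I_n) (l : R) c s a :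
  W \is unitarymx -> 0 < l < 1 -> path <%R a s ->
  (forall k, (k < size s)%N -> exists2 d, C1_curve d &
     forall t, nth 0 (a :: s) k <= t <= nth 0 s k -> c t = d t) ->
  (forall t, a <= t <= last a s -> c t \is unitarymx) ->
  measurable_fun `[a, last a s] (speed c) /\
  ((arcs W M l (c (last a s)) - arcs W M l (c a))%:E
   <= (Num.sqrt #|M|%:R)%:E
      * \int[lebesgue_measure]_(t in `[a, last a s]) (speed c t)%:E)%E.
Proof.
move=> Wu l01; elim: s a => [|b s IH] a /=.
  move=> _ _ _; rewrite subrr set_itv1; split; first exact: measurable_fun_set1.
  by rewrite integral_set1 mule0.
move=> /andP[ab bs] pieces cu.
have b_last := path_lt_le_last bs.
have cu' t : b <= t <= last b s -> c t \is unitarymx.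
  by case/andP=> bt tl; apply: cu; rewrite (le_trans (ltW ab) bt).
have [mS arcS] := IH b bs (fun k => pieces k.+1)
  cu'.
have [d dC1 cd] := pieces 0%N isT; rewrite /= in cd.
have [mP intP] := speed_piece dC1 cd.
have du t : a <= t <= b -> d t \is unitarymx.
  move=> tab; rewrite -(cd _ tab); apply: cu; case/andP: tab => -> tb /=.
  exact: le_trans tb b_last.
have arcP := arcs_piece M Wu l01 ab dC1 du.
have eb : d b = c b by apply/esym/cd; rewrite lexx ltW.
have ea : d a = c a by apply/esym/cd; rewrite lexx ltW.
rewrite eb ea -intP in arcP.
have [mA intA] := ge0_integral_itv_cat (ltW ab) b_last (fun t => sqrtr_ge0 _) mP mS.
split; first exact: mA.
rewrite {}intA.
rewrite ge0_muleDr; last 2 first.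
- by apply: integral_ge0 => t _; rewrite lee_fin sqrtr_ge0.
- by apply: integral_ge0 => t _; rewrite lee_fin sqrtr_ge0.
apply: le_trans (leeD arcP arcS).
by rewrite -EFinD lee_fin [leRHS]addrC addrA subrK.
Qed.

End Subdivision.

(** * Lower bound for distances *)

Section LowerBound.
Variables (R : realType) (n : nat).

(** This lets the factor [l] of [arcs] tend to 1: [s] stands for [sqrt #|M|], [p] for [pi], [e] for
    [acos l], and [x] for the length. *)
Lemma lower_bound_limit (s p x : R) : 0 <= s -> 0 < p -> 0 <= x ->
  (forall e, 0 < e < p / 2 -> s ^+ 2 * (p - 2 * e) <= s * x) -> s * p <= x.
Proof.
move=> s0 p0 x0 h; rewrite leNgt; apply/negP => xsp.
have s_gt0 : 0 < s.
  by rewrite lt_def s0 andbT; apply: contraTneq xsp => ->; rewrite mul0r -leNgt.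
(* For this [e], [s (p - 2 e)] is the midpoint of [x] and [s p], hence larger than [x]. *)
pose e := (s * p - x) / (4 * s).
have es : e * (4 * s) = s * p - x by rewrite mulfVK // mulf_neq0 ?gt_eqF.
have e0 : 0 < e by rewrite divr_gt0 ?subr_gt0 // mulr_gt0.
have ep : e < p / 2.
  by rewrite -(ltr_pM2r (_ : 0 < 4 * s)) ?mulr_gt0 // es; nra.
have := h e; rewrite e0 ep expr2 -mulrA ler_pM2l // => /(_ isT); nra.
Qed.

(** In the basis given by [W], each of the [#|M|] angles goes from [acos l] at the identity to
    [acos (- l) = pi - acos l] at [Y]. *)
Lemma dist_lower_bound (G : set 'M[R[i]]_n) (Y W : 'M[R[i]]_n) (M : pred 'I_n) :
  (forall X, G X -> X \is unitarymx) -> W \is unitarymx ->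
  (forall j, M j -> (W *m Y *m W ^t*) j j = -1) ->
  ((Num.sqrt #|M|%:R * pi)%:E <= riemannian_dist G (@frobenius R n) 1%:M Y)%E.
Proof.
move=> GU Wu YM; apply: le_ereal_inf_tmp => _ [c [[s [s0 s1 pieces]] Gc c0 c1] <-].
have cu t : 0 <= t <= last 0 s -> c t \is unitarymx by rewrite s1 => /Gc /GU.
have arcs0 l : arcs W M l 1%:M = #|M|%:R * acos l.
  rewrite /arcs /frame mulmx1 (unitarymxP Wu).
  under eq_bigr do rewrite mxE eqxx mulr1.
  by rewrite sumr_const mulr_natl.
have arcs1 l : arcs W M l Y = #|M|%:R * acos (- l).
  rewrite /arcs /frame mulr_natl -sumr_const; apply: eq_bigr => j Mj.
  by rewrite YM // /= mulrN mulr1.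
have key l : 0 < l < 1 -> ((#|M|%:R * (pi - 2 * acos l))%:E
    <= (Num.sqrt #|M|%:R)%:E * curve_length (@frobenius R n) c)%E.
  move=> l01; have [_] := arcs_subdivision M Wu l01 s0 pieces cu.
  rewrite s1 c0 c1 arcs0 arcs1 acosN; last first.
    by case/andP: l01 => l0 l1; rewrite (ltW l1) (le_trans _ (ltW l0)) // lerN10.
  by rewrite -mulrBr (_ : pi - acos l - acos l = pi - 2 * acos l) //; ring.
have L0 : (0 <= curve_length (@frobenius R n) c)%E.
  by apply: integral_ge0 => t _; rewrite lee_fin sqrtr_ge0.
move: key L0; case: (curve_length _ c) => [x| |] key L0 //; last by rewrite leey.
rewrite lee_fin; apply: lower_bound_limit; rewrite ?sqrtr_ge0 ?pi_gt0 -?lee_fin //.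
(* An [e] in []0, pi / 2[] is [acos l] for [l = cos e], which lies in []0, 1[]. *)
move=> e /andP[e0 ep]; rewrite sqr_sqrtr ?ler0n // -[e in leLHS](@cosK R); last first.
  rewrite in_itv /= ltW //= (le_trans (ltW ep)) // ler_pdivrMr //.
  by rewrite ler_peMr ?pi_ge0 // ler1n.
have := key (cos e); rewrite -EFinM lee_fin; apply.
rewrite cos_gt0_pihalf ?ep ?andbT; last first.
  by rewrite (lt_trans _ e0) // oppr_lt0 divr_gt0 ?pi_gt0.
rewrite -[1]cos0 ltr_cos ?in_itv /= ?lexx ?pi_ge0 ?(ltW e0) //=.
by rewrite (le_trans (ltW ep)) // ler_pdivrMr // ler_peMr ?pi_ge0 // ler1n.
Qed.

Lemma diameter_eq (G : set 'M[R[i]]_n) (phi : 'M[R[i]]_n -> 'M[R[i]]_n -> R)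
    (X0 Y0 : 'M[R[i]]_n) (a : \bar R) :
  (forall X Y, G X -> G Y -> (riemannian_dist G phi X Y <= a)%E) ->
  G X0 -> G Y0 -> (a <= riemannian_dist G phi X0 Y0)%E ->
  diameter G phi = a.
Proof.
move=> ub GX GY lb; apply/eqP; rewrite eq_le; apply/andP; split.
  by apply: ge_ereal_sup => _ [X [Y [GX' GY' ->]]]; exact: ub.
by apply: (le_trans lb); apply: ereal_sup_ubound; exists X0, Y0.
Qed.

End LowerBound.

(** * Points at maximal distance *)

Section Extremal.
Variables (C : numClosedFieldType) (n : nat).

Lemma unitary1 : (1%:M : 'M[C]_n) \is unitarymx.
Proof. by apply/unitarymxP; rewrite adj1 mulmx1. Qed.

Lemma unitaryN1 : (- 1%:M : 'M[C]_n) \is unitarymx.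
Proof. by apply/unitarymxP; rewrite adjN adj1 mulNmx mul1mx opprK. Qed.

Lemma frameN1 (j : 'I_n) : (1%:M *m - 1%:M *m (1%:M : 'M[C]_n) ^t*) j j = -1.
Proof. by rewrite adj1 mulmx1 mul1mx !mxE eqxx. Qed.

Lemma twisted1 (Q : 'M[C]_n) : 1%:M *m Q = Q *m cmx 1%:M.
Proof. by rewrite map_mx1 mul1mx mulmx1. Qed.

Lemma twistedN1 (Q : 'M[C]_n) : - 1%:M *m Q = Q *m cmx (- 1%:M).
Proof. by rewrite map_mxN map_mx1 mulNmx mulmxN mul1mx mulmx1. Qed.

Lemma detN1_even : ~~ odd n -> \det (- 1%:M : 'M[C]_n) = 1.
Proof.
by move=> n_even; rewrite -scaleN1r detZ det1 mulr1 -signr_odd (negPf n_even).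
Qed.

End Extremal.

(** The projection [P] onto the invariant line is real and commutes with [Q]; for a real matrix this
    is the twisted relation, which [2 P - 1] inherits. *)
Lemma twisted_SU_odd_extremal (R : realType) n (Q : 'M[R]_n) :
  O_ Q -> odd n -> exists Y W (M : pred 'I_n),
  [/\ twisted_commutant_SU Q Y, W \is unitarymx, #|M| = n.-1 &
      forall j, M j -> (W *m Y *m W ^t*) j j = -1].
Proof.
move=> QO n_odd; have [P [PT PP trP PQ]] := orthogonal_invariant_line QO n_odd.
pose Pc := map_mx (real_complex R) P.
have Pcreal : cmx Pc = Pc by apply/matrixP => i j; rewrite !mxE conj_complex /= oppr0.
have PcT : Pc^T = Pc by rewrite /Pc map_trmx PT.
have Pca : Pc ^t* = Pc by rewrite PcT.
have PcPc : Pc *m Pc = Pc by rewrite -map_mxM PP.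
have trPc : \tr Pc = 1 by rewrite trace_map_mx trP rmorph1.
have PcQ : Pc *m map_mx (real_complex R) Q = map_mx (real_complex R) Q *m cmx Pc.
  by rewrite Pcreal -!map_mxM PQ.
have [Yu dY [W [M [Wu Mn YM]]]] := line_reflection Pca PcPc trPc n_odd.
exists (Pc *+ 2 - 1%:M), W, M.
split; [|exact: Wu|exact: Mn|exact: YM]; split; first exact: conj Yu dY.
rewrite mulmxBl map_mxB mulmxBr !mulr2n mulmxDl map_mxD mulmxDr PcQ.
by rewrite (twisted1 (map_mx _ Q)).
Qed.

Theorem proposition6p7 (R : realType) :
  [/\ forall (n : nat) (V : 'M[R[i]]_n), (1 <= n)%N -> U_ V ->
        diameter (commutant_U V) (@frobenius R n)
        = (Num.sqrt (n%:R : R) * pi)%:E,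
      forall (n : nat) (Q : 'M[R]_n), (2 <= n)%N -> ~~ odd n -> O_ Q ->
        diameter (twisted_commutant_SU Q) (@frobenius R n)
        = (Num.sqrt (n%:R : R) * pi)%:E
    & forall (n : nat) (Q : 'M[R]_n), (1 <= n)%N -> odd n -> O_ Q ->
        diameter (twisted_commutant_SU Q) (@frobenius R n)
        = (Num.sqrt (n%:R - 1 : R) * pi)%:E].
Proof.
(* Here [W] is the identity and [M] contains all indices, since every diagonal entry of [- 1%:M] is
   -1. *)
have lbN1 n (G : set 'M[R[i]]_n) : (forall X, G X -> X \is unitarymx) ->
    ((Num.sqrt (n%:R : R) * pi)%:E
     <= riemannian_dist G (@frobenius R n) 1%:M (- 1%:M))%E.
  move=> GU; have := dist_lower_bound GU (unitary1 _ n) (M := predT)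
    (fun j _ => frameN1 _ j).
  by rewrite cardT size_enum_ord.
split=> n.
- move=> V _ _; apply: (diameter_eq (X0 := 1%:M) (Y0 := - 1%:M)).
  + exact: commutant_dist_le.
  + by split; [exact: unitary1|rewrite mul1mx mulmx1].
  + by split; [exact: unitaryN1|rewrite mulNmx mulmxN mul1mx mulmx1].
  + by apply: lbN1 => X [].
- move=> Q _ n_even QO; apply: (diameter_eq (X0 := 1%:M) (Y0 := - 1%:M)).
  + by move=> X Y; apply: twisted_dist_le => //; rewrite (negPf n_even).
  + by split; [split; [exact: unitary1|exact: det1]|exact: twisted1].
  + by split; [split; [exact: unitaryN1|exact: detN1_even]|exact: twistedN1].
  + by apply: lbN1 => X [[]].
move=> Q n_gt0 n_odd QO.
have [Y [W [M [GY Wu Mn YM]]]] := twisted_SU_odd_extremal QO n_odd.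
have -> : n%:R - 1 = n.-1%:R :> R by rewrite -subn1 natrB.
apply: (diameter_eq (X0 := 1%:M) (Y0 := Y)).
- by move=> X Z; apply: twisted_dist_le => //; rewrite n_odd.
- by split; [split; [exact: unitary1|exact: det1]|exact: twisted1].
- exact: GY.
- by rewrite -Mn; apply: dist_lower_bound Wu YM => X [[]].
Qed.
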